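(* The self-crossing polynomial $p_{sc}$, which assigns to an unoriented virtual tangle $T$ with $n$ ordered components $T_1,\ldots,T_n$ the polynomial $$p_{sc}(T)=\sum_{i=1}^n\ \sum_{c\in T_i}\mathrm{sgn}(c)\,\bigl(t_i^{|i(c)|}-1\bigr)\in\mathbb{Z}[t_1,\ldots,t_n]$$ (inner sum over the classical self-crossings $c$ of the component $T_i$), is a finite-type (Vassiliev) invariant of virtual tangles of order $\leq 1$.
   Context: **Virtual tangles.** A virtual tangle diagram is a generic immersion in a square of finitely many circles (closed components) and intervals (long components); the endpoints of the long components are fixed distinguished points on the top or bottom side of the square. Each transverse double point of the immersion is marked either as a classical crossing (with over/under information) or as a virtual crossing. Long components need not connect top to bottom, and the numbers of endpoints at top and bottom may differ. A virtual tangle is an equivalence class of such diagrams under planar isotopy (fixing endpoints), the classical Reidemeister moves 1, 2, 3 (on classical crossings), and the virtual Reidemeister moves: the analogues of moves 1, 2, 3 with all crossings virtual, and the mixed move in which a strand having only virtual crossings passes over/past a classical crossing. A virtual tangle is oriented if every component is oriented. The components are ordered $T_1,\ldots,T_n$, and the $i$-th component is assigned a variable $t_i$. **Sign.** The sign $\mathrm{sgn}(c)=\pm1$ of a classical crossing $c$ of oriented strands is $+1$ if (direction of over-strand, direction of under-strand) is a positively oriented basis of the plane, and $-1$ otherwise. For a self-crossing of one component the sign does not depend on the orientation chosen on that component. **Intersection index.** Let $c$ be a classical self-crossing of a component $T_i$ (with any orientation of $T_i$). Smooth $c$ according to orientation; $T_i$ is replaced by two oriented components $L_1,L_2$ (ordered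 arbitrarily). Forget the over/under information at the remaining classical crossings (pass to the flat diagram); virtual crossings remain virtual. To each flat (non-virtual) crossing $x$ between $L_1$ and $L_2$ assign the sign $\mathrm{sgn}(x)$ it would have as a classical crossing with $L_1$ over $L_2$. Then $i(c)=\sum_{x\in L_1\cap L_2}\mathrm{sgn}(x)$, ignoring crossings that involve components of the tangle other than $L_1,L_2$. Exchanging $L_1$ and $L_2$ changes $i(c)$ by a sign, so $|i(c)|$ is well defined. **Vassiliev invariants.** A singular virtual tangle is a virtual tangle whose diagrams may have an additional type of crossing, transverse double points, considered modulo the moves above and rigid vertex isotopy. A virtual tangle invariant $\nu$ is extended to singular virtual tangles by resolving each double point as $\nu(\text{double point})=\nu(\text{positive crossing})-\nu(\text{negative crossing})$; so for two double points $T_{dd'}=T_{++}-T_{+-}-T_{-+}+T_{--}$. The invariant $\nu$ is a finite-type (Vassiliev) invariant of order $\leq n$ if its extension vanishes on every singular virtual tangle with more than $n$ double points. *)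

(* Defs.v *)
(* mpoly is imported without its notations, which clash with those of
   mathcomp-analysis. *)
From HB Require Import structures.
From mathcomp Require Import all_boot all_order all_algebra.
From mathcomp Require Import -(notations, coercions) mpoly.
From mathcomp Require Import all_classical all_reals all_analysis.
Set Implicit Arguments.
Unset Strict Implicit.
Unset Printing Implicit Defensive.
Import Order.TTheory GRing.Theory Num.Theory numFieldNormedType.Exports.
Local Open Scope classical_set_scope.
Local Open Scope ring_scope.

Definition wedge (R : realType) (u v : R * R) : R := u.1 * v.2 - u.2 * v.1.

Definition unit_square (R : realType) : set (R * R) :=
  [set x | 0 <= x.1 <= 1 /\ 0 <= x.2 <= 1].

Definition open_unit_square (R : realType) : set (R * R) :=
  [set x | 0 < x.1 < 1 /\ 0 < x.2 < 1].

Definition top_or_bottom (R : realType) : set (R * R) :=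
  [set x | 0 <= x.1 <= 1 /\ (x.2 = 0 \/ x.2 = 1)].

Definition C1 (R : realType) (V : normedModType R) (f : R -> V) : Prop :=
  (forall t, derivable f t 1) /\ continuous (f^`())%classic.

(* [Over]: the first strand is the upper one; [Under]: the second one is. *)
Inductive crossing_mark := Over | Under | Virtual | Singular.

Definition flip_mark (m : crossing_mark) : crossing_mark :=
  match m with
  | Over => Under
  | Under => Over
  | Virtual => Virtual
  | Singular => Singular
  end.

(* A point of the parametrized 1-manifold: a component and a parameter. *)
Definition param (R : realType) (n : nat) : Type := ('I_n * R)%type.

(* Component i is a circle if [is_loop i], parametrized 1-periodically, with
   fundamental domain [0, 1[; otherwise it is an interval, parametrized by
   [0, 1], and the values of [curve i] outside [0, 1] are irrelevant (they only
   make one-sided derivatives at 0 and 1 unnecessary).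
   [mark p q] is relevant only if p and q are the two preimages of a double
   point; p is then the first strand. *)
Record diagram (R : realType) (n : nat) := Diagram {
  is_loop : 'I_n -> bool;
  curve : 'I_n -> R -> R * R;
  mark : param R n -> param R n -> crossing_mark }.

Definition in_domain (R : realType) (n : nat) (D : diagram R n)
    (p : param R n) : Prop :=
  0 <= p.2 /\ (if is_loop D p.1 then p.2 < 1 else p.2 <= 1).

Definition is_endpoint (R : realType) (n : nat) (D : diagram R n)
    (p : param R n) : Prop :=
  is_loop D p.1 = false /\ (p.2 = 0 \/ p.2 = 1).

Definition pos (R : realType) (n : nat) (D : diagram R n) (p : param R n) :
  R * R := curve D p.1 p.2.

Definition velocity (R : realType) (n : nat) (D : diagram R n)
  (p : param R n) : R * R := ((curve D p.1)^`())%classic p.2.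

Definition double_point (R : realType) (n : nat) (D : diagram R n)
    (p q : param R n) : Prop :=
  [/\ in_domain D p, in_domain D q, p <> q & pos D p = pos D q].

(* A diagram, possibly with singular crossings: a generic C^1 immersion in the
   square with consistently marked crossings. *)
Record generic_diagram (R : realType) (n : nat) (D : diagram R n) : Prop :=
  GenericDiagram {
  generic_C1 : forall i, C1 (curve D i);
  generic_periodic :
    forall i t, is_loop D i -> curve D i (t + 1) = curve D i t;
  generic_immersion : forall p, in_domain D p -> velocity D p <> 0;
  generic_endpoint : forall p, is_endpoint D p -> top_or_bottom (pos D p);
  generic_interior : forall p, in_domain D p -> ~ is_endpoint D p ->
    open_unit_square (pos D p);
  generic_double_interior : forall p q, double_point D p q ->
    open_unit_square (pos D p);
  generic_transverse : forall p q, double_point D p q ->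
    wedge (velocity D p) (velocity D q) <> 0;
  generic_no_triple : forall p q r,
    double_point D p q -> double_point D q r -> p = r;
  generic_finite : finite_set [set pq | double_point D pq.1 pq.2];
  generic_mark : forall p q, double_point D p q ->
    mark D q p = flip_mark (mark D p q) }.

Definition singular_point (R : realType) (n : nat) (D : diagram R n)
  (p q : param R n) : Prop := double_point D p q /\ mark D p q = Singular.

Definition virtual_diagram (R : realType) (n : nat) (D : diagram R n) : Prop :=
  generic_diagram D /\ forall p q, ~ singular_point D p q.

(* A diagram of an unoriented tangle is considered up to reparametrization of
   its components, including reversal; a circle may also be given another
   base point. *)

Definition wrap (R : realType) (loop : bool) (t : R) : R :=
  if loop then t - (Num.floor t)%:~R else t.

Definition reparametrized (R : realType) (n : nat) (D D' : diagram R n) :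
    Prop :=
  (forall i, is_loop D' i = is_loop D i) /\
  exists rho : 'I_n -> R -> R,
  let pull (p : param R n) : param R n :=
    (p.1, wrap (is_loop D p.1) (rho p.1 p.2)) in
  [/\ forall i, C1 (rho i),
      forall p, in_domain D p -> ((rho p.1)^`())%classic p.2 <> 0,
      forall i, if is_loop D i
        then (forall t, rho i (t + 1) = rho i t + 1) \/
             (forall t, rho i (t + 1) = rho i t - 1)
        else (rho i 0 = 0 /\ rho i 1 = 1) \/ (rho i 0 = 1 /\ rho i 1 = 0),
      forall p, in_domain D p -> pos D' p = curve D p.1 (rho p.1 p.2) &
      forall p q, double_point D' p q ->
        mark D' p q = mark D (pull p) (pull q)].

Definition dplane (R : realType) (f : R * R -> R * R) (x v : R * R) : R * R :=
  'd f x v.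

Definition jacobian (R : realType) (f : R * R -> R * R) (x : R * R) : R :=
  wedge (dplane f x (1, 0)) (dplane f x (0, 1)).

(* Planar isotopy: an ambient isotopy of the square, of class C^1 in the space
   variable and fixing the endpoints, carries D to D'.  As for curves, [Phi] is
   a total function, of which only the restriction to [0, 1] x unit_square
   matters. *)
Definition planar_isotopic (R : realType) (n : nat) (D D' : diagram R n) :
    Prop :=
  (forall i, is_loop D' i = is_loop D i) /\
  exists Phi : R -> R * R -> R * R,
  [/\ [/\ forall u x, differentiable (Phi u) x,
          continuous (fun z : R * (R * R) => Phi z.1 z.2) &
          forall v : R * R,
            continuous (fun z : R * (R * R) => dplane (Phi z.1) z.2 v)],
      forall x, unit_square x -> Phi 0 x = x,
      forall u, 0 <= u <= 1 ->
        [/\ set_bij (@unit_square R) (@unit_square R) (Phi u),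
            forall x, unit_square x -> jacobian (Phi u) x <> 0 &
            forall p, is_endpoint D p -> Phi u (pos D p) = pos D p],
      forall p, in_domain D p -> pos D' p = Phi 1 (pos D p) &
      forall p q, double_point D p q -> mark D' p q = mark D p q].

(* Reidemeister moves take place in an embedded disc phi(model_box) of the open
   square, which each of the two diagrams meets in the same finitely many arcs
   of components; these arcs are described in the coordinates of
   [-1, 1] x [-1, 1].  The parametrization of each component is supposed to be
   chosen so that no arc contains the parameters 0 and 1. *)

Definition model_box (R : realType) : set (R * R) :=
  [set x | -1 <= x.1 <= 1 /\ -1 <= x.2 <= 1].

Definition open_model_box (R : realType) : set (R * R) :=
  [set x | -1 < x.1 < 1 /\ -1 < x.2 < 1].

Definition disc_chart (R : realType) (phi : R * R -> R * R) : Prop :=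
  [/\ (forall x, differentiable phi x) /\
        (forall v : R * R, continuous (fun x => dplane phi x v)),
      set_inj (@model_box R) phi,
      forall x, model_box x -> jacobian phi x <> 0 &
      forall x, model_box x -> open_unit_square (phi x)].

Record strand (R : realType) (n : nat) := Strand {
  strand_comp : 'I_n; strand_lo : R; strand_hi : R }.

Definition strand_ok (R : realType) (n : nat) (S : strand R n) : Prop :=
  [/\ 0 < strand_lo S, strand_lo S < strand_hi S & strand_hi S < 1].

Definition on_strand (R : realType) (n : nat) (S : strand R n)
    (p : param R n) : Prop :=
  p.1 = strand_comp S /\ strand_lo S <= p.2 <= strand_hi S.

(* D and D' coincide outside the disc phi(model_box); inside it, strand a is
   phi \o sigma a in D and phi \o sigma' a in D'. *)
Definition local_change (R : realType) (n k : nat) (phi : R * R -> R * R)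
    (S : 'I_k -> strand R n) (sigma sigma' : 'I_k -> R -> R * R)
    (D D' : diagram R n) : Prop :=
  [/\ disc_chart phi /\ (forall i, is_loop D' i = is_loop D i),
      (forall a, strand_ok (S a)) /\
        (forall a b p, on_strand (S a) p -> on_strand (S b) p -> a = b),
      forall E p, E = D \/ E = D' -> in_domain E p ->
        (phi @` @model_box R) (pos E p) -> exists a, on_strand (S a) p,
      forall a t, strand_lo (S a) <= t <= strand_hi (S a) ->
        [/\ model_box (sigma a t), model_box (sigma' a t),
            curve D (strand_comp (S a)) t = phi (sigma a t) &
            curve D' (strand_comp (S a)) t = phi (sigma' a t)] &
      [/\ forall p, in_domain D p -> (forall a, ~ on_strand (S a) p) ->
            pos D' p = pos D p,
          forall a t, t = strand_lo (S a) \/ t = strand_hi (S a) ->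
            sigma' a t = sigma a t &
          forall p q, double_point D p q -> (forall a, ~ on_strand (S a) p) ->
            (forall a, ~ on_strand (S a) q) -> mark D' p q = mark D p q]].

Definition marked (R : realType) (n : nat) (D : diagram R n)
    (S T : strand R n) (m : crossing_mark) : Prop :=
  forall p q, on_strand S p -> on_strand T q -> double_point D p q ->
    mark D p q = m.

Definition proper_arc (R : realType) (lo hi : R) (sigma : R -> R * R) : Prop :=
  [/\ forall t, lo < t < hi -> open_model_box (sigma t),
      model_box (sigma lo) /\ ~ open_model_box (sigma lo) &
      model_box (sigma hi) /\ ~ open_model_box (sigma hi)].

(* Move 1, classical or virtual according to the mark of the removed crossing:
   an arc with a single double point is a curl; it is replaced by an embedded
   arc. *)
Definition reidemeister1 (R : realType) (n : nat) (D D' : diagram R n) : Prop :=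
  exists (phi : R * R -> R * R) (S : strand R n) (sigma sigma' : R -> R * R),
  let lo := strand_lo S in let hi := strand_hi S in
  [/\ local_change phi (fun _ : 'I_1 => S) (fun=> sigma) (fun=> sigma') D D',
      proper_arc lo hi sigma /\ proper_arc lo hi sigma',
      exists s t, lo < s < t /\ t < hi /\
        forall s' t', lo <= s' < t' -> t' <= hi ->
          sigma s' = sigma t' <-> s' = s /\ t' = t &
      forall s' t', lo <= s' < t' -> t' <= hi -> sigma' s' <> sigma' t'].

(* The graph of g over [-1, 1], traversed from left to right if [e], and from
   right to left otherwise. *)
Definition graph_arc (R : realType) (n : nat) (S : strand R n) (e : bool)
    (g : R -> R) (t : R) : R * R :=
  let x0 :=
    2%:R * (t - strand_lo S) / (strand_hi S - strand_lo S) - 1 in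
  let x := if e then x0 else - x0 in (x, g x).

Definition height_fun (R : realType) (g : R -> R) : Prop :=
  C1 g /\ forall x, -1 <= x <= 1 -> -1 < g x < 1.

(* Move 2, classical (m = Over or Under: one strand is above the other at both
   crossings) or virtual (m = Virtual): two graphs meeting twice are replaced by
   two disjoint ones. *)
Definition reidemeister2 (R : realType) (n : nat) (D D' : diagram R n) : Prop :=
  exists (phi : R * R -> R * R) (S : 'I_2 -> strand R n) (e : 'I_2 -> bool)
         (g h : 'I_2 -> R -> R) (m : crossing_mark),
  let i0 : 'I_2 := ord0 in let i1 : 'I_2 := ord_max in
  [/\ local_change phi S (fun a => graph_arc (S a) (e a) (g a))
        (fun a => graph_arc (S a) (e a) (h a)) D D',
      forall a, height_fun (g a) /\ height_fun (h a),
      exists x1 x2, -1 < x1 < x2 /\ x2 < 1 /\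
        forall x, -1 <= x <= 1 -> g i0 x = g i1 x <-> x = x1 \/ x = x2,
      forall x, -1 <= x <= 1 -> h i0 x <> h i1 x &
      m <> Singular /\ marked D (S i0) (S i1) m].

(* Two crossing lines, and the graph of g. *)
Definition triangle_graphs (R : realType) (g : R -> R) (a : 'I_3) : R -> R :=
  match val a with
  | 0%N => fun x => x / 2%:R
  | 1%N => fun x => - x / 2%:R
  | _ => g
  end.

Definition meets_lines_once (R : realType) (g : R -> R) : Prop :=
  [/\ height_fun g,
      forall x, -1 <= x <= 1 -> - 2%:R^-1 < g x < 2%:R^-1,
      exists! x, -1 <= x <= 1 /\ g x = x / 2%:R &
      exists! x, -1 <= x <= 1 /\ g x = - x / 2%:R].

(* The crossing of strands a < b of the triangle is marked m a b.
   Classical: the three strands lie at different heights.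
   Virtual: all crossings are virtual.
   Mixed: strand c has only virtual crossings, the other crossing is
   classical. *)
Definition triangle_marks (m : 'I_3 -> 'I_3 -> crossing_mark) : Prop :=
  [\/ exists level : 'I_3 -> nat, injective level /\
        forall a b : 'I_3, (a < b)%N ->
          m a b = if (level b < level a)%N then Over else Under,
      forall a b : 'I_3, (a < b)%N -> m a b = Virtual |
      exists c : 'I_3, forall a b : 'I_3, (a < b)%N ->
        if (a == c) || (b == c) then m a b = Virtual
        else m a b = Over \/ m a b = Under].

(* Move 3, classical, virtual or mixed: the graph passes from above to below
   the crossing point (0, 0) of the two lines. *)
Definition reidemeister3 (R : realType) (n : nat) (D D' : diagram R n) : Prop :=
  exists (phi : R * R -> R * R) (S : 'I_3 -> strand R n) (e : 'I_3 -> bool)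
         (g h : R -> R) (m : 'I_3 -> 'I_3 -> crossing_mark),
  [/\ local_change phi S
        (fun a => graph_arc (S a) (e a) (triangle_graphs g a))
        (fun a => graph_arc (S a) (e a) (triangle_graphs h a)) D D',
      meets_lines_once g /\ 0 < g 0,
      meets_lines_once h /\ h 0 < 0,
      triangle_marks m &
      forall a b : 'I_3, (a < b)%N ->
        marked D (S a) (S b) (m a b) /\ marked D' (S a) (S b) (m a b)].

Definition elementary_move (R : realType) (n : nat) (D D' : diagram R n) :
    Prop :=
  [\/ reparametrized D D' \/ planar_isotopic D D',
      reidemeister1 D D', reidemeister2 D D' | reidemeister3 D D'].

(* Two diagrams represent the same virtual tangle. *)
Inductive tangle_equiv (R : realType) (n : nat) :
    diagram R n -> diagram R n -> Prop :=
| tangle_equiv_move D D' : virtual_diagram D -> virtual_diagram D' ->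
    elementary_move D D' -> tangle_equiv D D'
| tangle_equiv_refl D : virtual_diagram D -> tangle_equiv D D
| tangle_equiv_sym D D' : tangle_equiv D D' -> tangle_equiv D' D
| tangle_equiv_trans D D' D'' :
    tangle_equiv D D' -> tangle_equiv D' D'' -> tangle_equiv D D''.

Definition tangle_invariant (R : realType) (n : nat) (A : zmodType)
    (nu : diagram R n -> A) : Prop :=
  forall D D', tangle_equiv D D' -> nu D = nu D'.

(* The sign of a crossing, p being on the upper strand and q on the lower one. *)
Definition sgn (R : realType) (n : nat) (D : diagram R n) (p q : param R n) :
  int := sgz (wedge (velocity D p) (velocity D q)).

(* Resolution of the double point d into the crossing of sign + if [b], and of
   sign - otherwise. *)
Definition resolve (R : realType) (n : nat) (D : diagram R n)
    (d : param R n * param R n) (b : bool) : diagram R n :=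
  let m := if (0 < sgn D d.1 d.2) == b then Over else Under in
  Diagram (is_loop D) (curve D)
    (fun p q => if (p, q) == d then m
                else if (q, p) == d then flip_mark m
                else mark D p q).

Definition lists_singular_points (R : realType) (n : nat) (D : diagram R n)
    (ds : seq (param R n * param R n)) : Prop :=
  [/\ uniq ds,
      forall d, d \in ds -> singular_point D d.1 d.2 &
      forall p q, singular_point D p q ->
        ((p, q) \in ds) (+) ((q, p) \in ds)].

(* The extension of nu to the singular diagram D whose double points are ds. *)
Fixpoint extend (R : realType) (n : nat) (A : zmodType)
    (nu : diagram R n -> A) (D : diagram R n)
    (ds : seq (param R n * param R n)) : A :=
  match ds with
  | [::] => nu D
  | d :: ds' =>
      extend nu (resolve D d true) ds' - extend nu (resolve D d false) ds'
  end.

(* Vanishing on every diagram with more than k double points is vanishing on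
   every singular tangle with more than k double points, whatever the
   equivalence relation on singular diagrams. *)
Definition finite_type_order_le (R : realType) (n : nat) (A : zmodType)
    (nu : diagram R n -> A) (k : nat) : Prop :=
  tangle_invariant nu /\
  forall D ds, generic_diagram D -> lists_singular_points D ds ->
    (k < size ds)%N -> extend nu D ds = 0.

(* Smoothing the self-crossing (i, s), (i, t) according to the orientation cuts
   component i into the part between the two parameters and the rest, both with
   the orientation of i. *)
Definition smoothing_inner (R : realType) (s t : R) : set R :=
  [set u | Num.min s t < u < Num.max s t].

Definition smoothing_outer (R : realType) (n : nat) (D : diagram R n)
    (i : 'I_n) (s t : R) : set R :=
  [set u | in_domain D (i, u) /\ (u < Num.min s t \/ Num.max s t < u)].

Definition flat_crossings (R : realType) (n : nat) (D : diagram R n)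
    (i : 'I_n) (L1 L2 : set R) : set (R * R) :=
  [set x | [/\ L1 x.1, L2 x.2, double_point D (i, x.1) (i, x.2) &
               mark D (i, x.1) (i, x.2) <> Virtual]].

Definition intersection_index (R : realType) (n : nat) (D : diagram R n)
    (i : 'I_n) (s t : R) : int :=
  \sum_(x \in flat_crossings D i (smoothing_inner s t)
                                 (smoothing_outer D i s t))
    sgn D (i, x.1) (i, x.2).

(* The classical self-crossings of component i, as pairs of the parameters of
   the upper and of the lower strand. *)
Definition self_crossings (R : realType) (n : nat) (D : diagram R n)
    (i : 'I_n) : set (R * R) :=
  [set c | double_point D (i, c.1) (i, c.2) /\
           mark D (i, c.1) (i, c.2) = Over].

Definition tvar (n : nat) (i : 'I_n) : mpoly n int := mpolyX int (mnm1 i).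

Definition p_sc (R : realType) (n : nat) (D : diagram R n) : mpoly n int :=
  \sum_(i < n) \sum_(c \in self_crossings D i)
    (tvar i ^+ `|intersection_index D i c.1 c.2|%N - 1)
      *~ sgn D (i, c.1) (i, c.2).

(* Main.v *)
Require Import Defs.
From mathcomp Require Import all_boot all_order all_algebra.
From mathcomp Require Import -(notations, coercions) mpoly.
From mathcomp Require Import all_classical all_reals all_analysis.
From mathcomp Require Import ring lra zify.

(** The index of a self-crossing counts, with signs, the flat crossings between
    the two parts into which its two parameters cut the component
    ([intersection_indexE]).  It depends on the flat diagram only, and a swap of
    the two parts changes its sign ([weight_swap]), which the absolute value
    forgets.

    A planar isotopy or a reparametrization matches the crossings of the two
    diagrams, with their marks and the signs of the self-crossings: an isotopy
    has a positive Jacobian, and a reversal of a component changes both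
    velocities at a self-crossing.  The two parts of a smoothed component are
    preserved, or swapped when the base point of a circle has moved from one part
    to the other ([p_sc_correspondence]).

    A Reidemeister move changes nothing outside its disc ([local_p_sc]).  Seen
    from a crossing outside the disc, each strand in the disc lies in one of the
    two parts.  In the first move the crossing joins a strand to itself, so it
    does not contribute to other indices, and its own index is 0 because the loop
    of the curl meets nothing else.  In the second move the two crossings have
    opposite signs ([slope_alternate]) and the same index, so that both their
    contributions to other indices and their terms cancel.  In the third move all
    signs are unchanged, and so are the contributions to indices outside; in the
    index of the crossing of two of the strands, the crossings of the third one
    with these two change sides, and the two changes cancel ([crossing_index]).
    This cancellation supposes that the third strand meets the other two with
    crossings that are both flat or both virtual, which is what the classical and
    mixed versions of the move have in common.

    As to the order, a double point d is a flat crossing before and after its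
    resolution.  Hence resolving d adds to the polynomial a term
    t ^ |i(d)| - 1 with sign + or -, which the resolution of other double points
    does not affect ([p_sc_resolve]): second differences vanish
    ([extend_p_sc_eq0]). *)
Set Implicit Arguments.
Unset Strict Implicit.
Unset Printing Implicit Defensive.
Import Order.TTheory GRing.Theory Num.Theory numFieldNormedType.Exports.
Local Open Scope classical_set_scope.
Local Open Scope ring_scope.

(** * Derivatives, signs and determinants *)

Section Calculus.
Variable R : realType.

(** The parameter 0 of a circle is the left end of its fundamental domain, and
    strands are closed intervals: two curves are in general known to agree only
    to the right of a parameter. *)
Lemma derive1_right_eq (V : normedModType R) (f g : R -> V) (t e : R) :
  derivable f t 1 -> derivable g t 1 -> 0 < e ->
  (forall u, t <= u < t + e -> f u = g u) -> (f^`() t)%classic = (g^`() t)%classic.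
Proof.
move=> df dg e0 fg; rewrite !derive1E /derive.
have /cvg_dnbhs_at_right Hf :
  h^-1 *: ((f \o shift t) (h *: 1) - f t) @[h --> 0^'] --> 'D_1 f t := df.
have /cvg_dnbhs_at_right Hg :
  h^-1 *: ((g \o shift t) (h *: 1) - g t) @[h --> 0^'] --> 'D_1 g t := dg.
apply: (@norm_cvg_unique _ _ _ _ _ _ Hf).
apply: cvg_trans Hg; apply: near_eq_cvg.
near=> h => /=.
have h0 : 0 < h by near: h; exact: nbhs_right_gt.
have he : h < e by near: h; apply: nbhs_right_lt.
by rewrite /shift /= /GRing.scale /= mulr1 !fg ?lexx ?ltrDl //; lra.
Unshelve. all: by end_near. Qed.

Lemma derive1_scalar_comp (V : normedModType R) (c : R -> V) (r : R -> R) t :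
  derivable c (r t) 1 -> derivable r t 1 ->
  ((c \o r)^`() t)%classic = (r^`() t)%classic *: (c^`() (r t))%classic.
Proof.
move=> /derivable1_diffP dc /derivable1_diffP dr.
rewrite (derive1E' (differentiable_comp dr dc)) (diff_comp dr dc) /=.
have -> : 'd r t 1 = (r^`() t)%classic by rewrite (derive1E' dr).
by rewrite (diff1E dc).
Qed.

Lemma derive1_addr (V : normedModType R) (f : R -> V) (c : V) t :
  derivable f t 1 ->
  derivable (fun u => f u + c) t 1 /\
  ((fun u => f u + c)^`() t)%classic = (f^`() t)%classic.
Proof.
move=> df; split; first exact: derivableD.
by rewrite !derive1E (deriveD df (derivable_cst _ _ _)) derive_cst addr0.
Qed.

Lemma derive1_shift (V : normedModType R) (f : R -> V) (c t : R) :
  derivable f (t + c) 1 ->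
  ((fun u => f (u + c))^`() t)%classic = (f^`() (t + c))%classic.
Proof.
move=> df; have did : derivable (@id R) t 1 by exact: derivable_id.
have [ds s1] := derive1_addr c did.
have E := derive1_scalar_comp (r := fun u => u + c) df ds.
by apply: etrans E _; rewrite s1 derive1E derive_id scale1r.
Qed.

Lemma derive1_diff_comp (V W : normedModType R) (f : V -> W) (c : R -> V) t :
  derivable c t 1 -> differentiable f (c t) ->
  ((f \o c)^`() t)%classic = 'd f (c t) (c^`() t)%classic.
Proof.
move=> /derivable1_diffP dc df.
rewrite (derive1E' (differentiable_comp dc df)) (diff_comp dc df) /=.
by rewrite -(derive1E' dc).
Qed.

Lemma derivable_diff_comp (V W : normedModType R) (f : V -> W) (c : R -> V) t :
  derivable c t 1 -> differentiable f (c t) -> derivable (f \o c) t 1.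
Proof.
by move=> /derivable1_diffP dc df; apply/derivable1_diffP/differentiable_comp.
Qed.

(** A linear map of the plane multiplies signed areas by its determinant. *)
Lemma wedge_diff (f : R * R -> R * R) x u v : differentiable f x ->
  wedge ('d f x u) ('d f x v) = Defs.jacobian f x * wedge u v.
Proof.
move=> df; case: u v => [u1 u2] [v1 v2].
have E (a b : R) : ((a, b) : R * R) = a *: (1, 0) + b *: (0, 1).
  by congr pair; rewrite /= /GRing.scale /= ?mulr1 ?mulr0 ?addr0 ?add0r.
rewrite (E u1 u2) (E v1 v2) !linearD !linearZ /Defs.jacobian /dplane /wedge /=.
rewrite /GRing.scale /=; ring.
Qed.

Lemma wedgeC (u v : R * R) : wedge v u = - wedge u v.
Proof. rewrite /wedge; ring. Qed.

Lemma wedgeZ (a b : R) (u v : R * R) :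
  wedge (a *: u) (b *: v) = a * b * wedge u v.
Proof. rewrite /wedge /= /GRing.scale /=; ring. Qed.

Lemma sgz_nonvanishing (f : R -> R) (a b : R) :
  continuous f -> a <= b -> (forall x, a <= x <= b -> f x <> 0) ->
  sgz (f a) = sgz (f b).
Proof.
move=> cf ab f0.
have fa := f0 a; have fb := f0 b.
have [//|] := eqVneq (sgz (f a)) (sgz (f b)) => ne.
have [||c + c0] := @IVT R f a b 0 ab.
- exact: continuous_subspaceT.
- rewrite ge_min le_max; move: ne fa fb; rewrite !sgz_def.
  by case: (ltgtP (f a) 0) => // ?; case: (ltgtP (f b) 0).
- by rewrite in_itv /= => /f0; rewrite c0.
Qed.

Lemma continuous_jacobian (T : topologicalType) (F : T -> R * R -> R * R)
    (x : T -> R * R) :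
  (forall v, continuous (fun t => dplane (F t) (x t) v)) ->
  continuous (fun t => Defs.jacobian (F t) (x t)).
Proof.
move=> cF t; rewrite /Defs.jacobian /wedge.
have c1 := cF (1, 0) t; have c2 := cF (0, 1) t.
have fstc (z : R * R) : {for z, continuous (fst : R * R -> R)} by exact: cvg_fst.
have sndc (z : R * R) : {for z, continuous (snd : R * R -> R)} by exact: cvg_snd.
have c11 := continuous_comp c1 (fstc _); have c12 := continuous_comp c1 (sndc _).
have c21 := continuous_comp c2 (fstc _); have c22 := continuous_comp c2 (sndc _).
exact: cvgB (cvgM c11 c22) (cvgM c12 c21).
Qed.

Lemma sgz_jacobian_segment (phi : R * R -> R * R) x y :
  (forall v, continuous (fun x => dplane phi x v)) ->
  (forall u, 0 <= u <= 1 -> Defs.jacobian phi (x + u *: (y - x)) <> 0) ->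
  sgz (Defs.jacobian phi x) = sgz (Defs.jacobian phi y).
Proof.
move=> cphi nz; pose p u := x + u *: (y - x).
have := @sgz_nonvanishing (fun u => Defs.jacobian phi (p u)) 0 1 _ ler01 nz.
rewrite /p scale0r scale1r addr0 subrKC; apply.
have cJ := continuous_jacobian (F := fun=> phi) (x := id) cphi.
move=> u; apply: (@continuous_comp _ _ _ p (Defs.jacobian phi)); last exact: cJ.
apply: cvgD; first exact: cvg_cst.
by apply: cvgZr_tmp; exact: cvg_id.
Qed.

Lemma derive1_ge0_right (f : R -> R) (a e : R) :
  derivable f a 1 -> f a = 0 -> 0 < e ->
  (forall u, a < u < a + e -> 0 <= f u) -> 0 <= (f^`() a)%classic.
Proof.
move=> df fa0 e0 fge; rewrite derive1E.
have /cvg_dnbhs_at_right Hf :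
  h^-1 *: ((f \o shift a) (h *: 1) - f a) @[h --> 0^'] --> 'D_1 f a := df.
have -> : 'D_1 f a = lim (h^-1 *: ((f \o shift a) (h *: 1) - f a) @[h --> 0^'+]).
  by apply/esym/(cvg_lim (@norm_hausdorff _ _) Hf).
apply: limr_ge; first by apply/cvg_ex; exists ('D_1 f a).
near=> h => /=.
have h0 : 0 < h by near: h; exact: nbhs_right_gt.
have he : h < e by near: h; apply: nbhs_right_lt.
rewrite fa0 subr0 /GRing.scale /= mulr1.
by apply: mulr_ge0; [rewrite invr_ge0 ltW|apply: fge; lra].
Unshelve. all: by end_near. Qed.

Lemma derive1_le0_left (f : R -> R) (a e : R) :
  derivable f a 1 -> f a = 0 -> 0 < e ->
  (forall u, a - e < u < a -> 0 <= f u) -> (f^`() a)%classic <= 0.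
Proof.
move=> df fa0 e0 fge; rewrite derive1E.
have /cvg_dnbhs_at_left Hf :
  h^-1 *: ((f \o shift a) (h *: 1) - f a) @[h --> 0^'] --> 'D_1 f a := df.
have -> : 'D_1 f a = lim (h^-1 *: ((f \o shift a) (h *: 1) - f a) @[h --> 0^'-]).
  by apply/esym/(cvg_lim (@norm_hausdorff _ _) Hf).
apply: limr_le; first by apply/cvg_ex; exists ('D_1 f a).
near=> h => /=.
have h0 : h < 0 by near: h; exact: nbhs_left_lt.
have he : - e < h by near: h; apply: nbhs_left_gt; rewrite oppr_lt0.
rewrite fa0 subr0 /GRing.scale /= mulr1.
by apply: mulr_le0_ge0; [rewrite invr_le0 ltW|apply: fge; lra].
Unshelve. all: by end_near. Qed.

End Calculus.

Lemma derivable_continuous (R : realType) (f : R -> R) :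
  (forall x, derivable f x 1) -> continuous f.
Proof. by move=> df x; apply: differentiable_continuous; apply/derivable1_diffP. Qed.

(** Consecutive transverse zeros are crossed in opposite directions, which is why
    the two crossings of the second move have opposite signs. *)
Lemma slope_alternate (R : realType) (f : R -> R) x1 x2 :
  (forall x, derivable f x 1) -> x1 < x2 -> f x1 = 0 -> f x2 = 0 ->
  (forall x, x1 < x < x2 -> f x <> 0) ->
  (f^`() x1)%classic <> 0 -> (f^`() x2)%classic <> 0 ->
  sgz (f^`() x1)%classic = - sgz (f^`() x2)%classic.
Proof.
wlog pos : f / 0 < f ((x1 + x2) / 2%:R).
  move=> W df x12 f1 f2 nz n1 n2.
  have mid : x1 < (x1 + x2) / 2%:R < x2 by lra.
  have [p|p|] := ltgtP 0 (f ((x1 + x2) / 2%:R)); first exact: W.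
    have dN x : ((fun u => - f u)^`() x)%classic = - (f^`() x)%classic.
      by rewrite !derive1E; exact: deriveN.
    have := W (fun u => - f u); rewrite !dN !sgzN.
    move=> /(_ _ _ x12) H; apply: oppr_inj; apply: H => //.
    - by rewrite oppr_gt0.
    - by move=> x; exact: derivableN.
    - by rewrite f1 oppr0.
    - by rewrite f2 oppr0.
    - by move=> x /nz h /eqP; rewrite oppr_eq0 => /eqP.
    - by move=> /eqP; rewrite oppr_eq0 => /eqP.
    - by move=> /eqP; rewrite oppr_eq0 => /eqP.
  by move=> /esym /(nz _ mid).
move=> df x12 f1 f2 nz n1 n2.
have cf := derivable_continuous df.
have gt0 x : x1 < x < x2 -> 0 < f x.
  move=> xi; rewrite -sgz_cp0; apply/eqP; apply/esym.
  rewrite -(gtr0_sgz pos); case: (leP x ((x1 + x2) / 2%:R)) => h.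
    by apply/esym; apply: sgz_nonvanishing => // y yi; apply: nz; lra.
  by apply: sgz_nonvanishing => //; [exact: ltW|move=> y yi; apply: nz; lra].
have p1 : 0 <= (f^`() x1)%classic.
  apply: (@derive1_ge0_right _ f x1 (x2 - x1)) => //; first by rewrite subr_gt0.
  by move=> u ui; apply/ltW/gt0; lra.
have p2 : (f^`() x2)%classic <= 0.
  apply: (@derive1_le0_left _ f x2 (x2 - x1)) => //; first by rewrite subr_gt0.
  by move=> u ui; apply/ltW/gt0; lra.
rewrite gtr0_sgz ?ltr0_sgz ?opprK //; rewrite lt_neqAle.
  by rewrite p2 andbT; apply/eqP.
by rewrite p1 andbT eq_sym; apply/eqP.
Qed.

(** Applied to the difference of two graphs whose order is reversed between the
    two edges of the box and which meet once: the sign of the slope gives the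
    sign of the crossing, and the sign at 0 tells on which side of 0 it lies. *)
Lemma single_zero (R : realType) (f : R -> R) (p : R) :
  (forall x, derivable f x 1) -> 0 < f (-1) -> f 1 < 0 ->
  (forall x, -1 <= x <= 1 -> f x = 0 <-> x = p) -> -1 <= p <= 1 ->
  [/\ -1 < p < 1, (f^`() p)%classic <= 0, 0 < f 0 -> 0 < p & f 0 < 0 -> p < 0].
Proof.
move=> df fl fr zero pi; have cf := derivable_continuous df.
have fp : f p = 0 by apply/zero.
have left x : -1 <= x < p -> 0 < f x.
  move=> /andP[x1 xp]; rewrite -sgz_cp0; apply/eqP/esym.
  rewrite -(gtr0_sgz fl); apply: sgz_nonvanishing => // y /andP[y1 yx] /zero yp.
  have /yp yE : -1 <= y <= 1 by rewrite y1; lra.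
  by move: xp yx; rewrite yE => /lt_le_trans h /h; rewrite ltxx.
have right x : p < x <= 1 -> f x < 0.
  move=> /andP[px x1]; rewrite -sgz_cp0; apply/eqP.
  rewrite -(ltr0_sgz fr); apply: sgz_nonvanishing => // y /andP[xy y1] /zero yp.
  have /yp yE : -1 <= y <= 1 by lra.
  by move: px xy; rewrite yE => /lt_le_trans h /h; rewrite ltxx.
have p1 : -1 < p < 1.
  move: pi => /andP[]; rewrite !le_eqVlt => /orP[/eqP pE|->] /orP[/eqP pE'|->] //.
  - by exfalso; move: fl; rewrite pE fp ltxx.
  - by exfalso; move: fl; rewrite pE fp ltxx.
  - by exfalso; move: fr; rewrite -pE' fp ltxx.
split=> //.
- apply: (@derive1_le0_left _ f p (p + 1)) => //; first lra.
  by move=> u ui; apply/ltW/left; lra.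
- move=> f0; case: (ltgtP 0 p) => // [p0|pE]; last first.
    have f00 : f 0 = 0 by rewrite {1}pE.
    by exfalso; move: f0; rewrite f00 ltxx.
  have := right 0; rewrite p0 ler01 => /(_ isT) f0'.
  by exfalso; move: (lt_trans f0 f0'); rewrite ltxx.
- move=> f0; case: (ltgtP 0 p) => // [p0|pE]; last first.
    have f00 : f 0 = 0 by rewrite {1}pE.
    by exfalso; move: f0; rewrite f00 ltxx.
  have := left 0; rewrite p0 lerN10 => /(_ isT) f0'.
  by exfalso; move: (lt_trans f0 f0'); rewrite ltxx.
Qed.

(** The shape taken by the wedge of two velocities in a chart: j is a Jacobian, ca
    and cb are the speeds of two graphs, and d is the difference of their slopes. *)
Lemma sgz_mul4 (R : realType) (j j0 ca cb d : R) (da db : int) :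
  sgz j = sgz j0 -> sgz ca = da -> sgz cb = db ->
  sgz (j * (ca * cb * d)) = sgz j0 * (da * db) * sgz d.
Proof. by move=> <- <- <-; rewrite !sgzM !mulrA. Qed.

(** * The intersection index as a signed sum over flat crossings *)

Lemma sgn_swap (R : realType) (n : nat) (D : diagram R n) p q :
  sgn D q p = - sgn D p q.
Proof. by rewrite [LHS]/sgn wedgeC sgzN. Qed.

(** This lemma and the next ones fix the monoid of the big operator before any
    unification takes place. *)
Lemma reindex_fsum (I J : choiceType) (V : nmodType) (h : I -> J) P Q (F : J -> V) :
  set_bij P Q h -> \sum_(j \in Q) F j = \sum_(i \in P) F (h i).
Proof. exact: reindex_fsbig. Qed.

Lemma fsumD1 (T : choiceType) (V : nmodType) (i : T) A (F : T -> V) :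
  finite_set A -> A i ->
  \sum_(j \in A) F j = F i + \sum_(j \in A `\ i) F j.
Proof. exact: fsbigD1. Qed.

Lemma fsumID (T : choiceType) (V : nmodType) (B A : set T) (F : T -> V) :
  finite_set A -> \sum_(j \in A) F j
  = \sum_(j \in A `&` B) F j + \sum_(j \in A `&` ~` B) F j.
Proof. exact: fsbigID. Qed.

Lemma eq_fsumr (T : choiceType) (V : nmodType) (A B : set T) (F G : T -> V) :
  A = B -> (forall x, B x -> F x = G x) ->
  \sum_(j \in A) F j = \sum_(j \in B) G j.
Proof. by move=> -> FG; apply: eq_fsbigr => x; rewrite inE; exact: FG. Qed.

Lemma fsum_seq (T : choiceType) (V : nmodType) (r : seq T) A (F : T -> V) :
  uniq r -> A = [set` r] -> \sum_(j \in A) F j = \sum_(j <- r) F j.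
Proof. by move=> ur ->; apply/esym; exact: fsbig_seq. Qed.

Lemma fsum_eq0 (T : choiceType) (V : nmodType) (A : set T) (F : T -> V) :
  (forall x, A x -> F x = 0) -> \sum_(j \in A) F j = 0.
Proof. exact: fsbig1. Qed.

Lemma absz_eq_or_opp (a b : int) : a = b \/ a = - b -> absz a = absz b.
Proof. by case=> ->; rewrite ?abszN. Qed.

Lemma fsumrN (T : choiceType) (A : set T) (f : T -> int) :
  \sum_(x \in A) - f x = - \sum_(x \in A) f x.
Proof.
by rewrite -mulN1r mulr_fsumr; apply: eq_fsbigr => x _; rewrite mulN1r.
Qed.

Section Index.
Variables (R : realType) (n : nat).
Implicit Types (D : diagram R n) (i : 'I_n).

Local Arguments sgn : simpl never.
(* Otherwise unification unfolds signs down to the order of R. *)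
Local Opaque sgn.

Definition double_pairs D i : set (R * R) :=
  [set x | double_point D (i, x.1) (i, x.2)].

Definition flat_pairs D i : set (R * R) :=
  [set x | double_pairs D i x /\ mark D (i, x.1) (i, x.2) <> Virtual].

Definition inside (s t u : R) : bool := Num.min s t < u < Num.max s t.

Definition outside (s t u : R) : bool :=
  (u < Num.min s t) || (Num.max s t < u).

(** Extending the summand by zero makes the index a sum over a set that does not
    depend on the crossing that is smoothed. *)
Definition weight D i (s t : R) (x : R * R) : int :=
  if inside s t x.1 && outside s t x.2 then sgn D (i, x.1) (i, x.2) else 0.

Definition crossing_term D i (c : R * R) : mpoly n int :=
  (tvar i ^+ `|intersection_index D i c.1 c.2|%N - 1)
    *~ sgn D (i, c.1) (i, c.2).

Lemma intersection_indexE D i s t :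
  intersection_index D i s t = \sum_(x \in flat_pairs D i) weight D i s t x.
Proof.
rewrite /intersection_index fsbig_mkcond [RHS]fsbig_mkcond.
apply: eq_fsbigr => x _; rewrite /patch /weight.
case: (boolP (x \in flat_pairs D i)); rewrite (inE, notin_setE).
  move=> [dx mx]; case: ifPn; rewrite (inE, notin_setE).
    move=> [i1 [_ o2] _ _]; rewrite /inside i1 /=.
    by case: ifPn => // /negP; case; apply/orP.
  move=> nx; case: ifPn => // /andP[i1 /orP o2]; case: nx; split => //.
  by split => //; case: dx.
move=> nx; case: ifPn => //; rewrite inE => -[? ? ? ?].
by case: nx; split.
Qed.

Lemma intersection_indexC D i s t :
  intersection_index D i t s = intersection_index D i s t.
Proof. by rewrite !intersection_indexE /weight /inside /outside minC maxC. Qed.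

(** An exclusive or of comparisons is easy to follow when the order of the
    parameters is reversed or their base point moves. *)
Lemma insideE s t u : u != s -> u != t -> inside s t u = (s < u) (+) (t < u).
Proof.
rewrite /inside gt_min lt_max; case: (ltgtP u s) => // us _;
  case: (ltgtP u t) => // ut _ //=.
Qed.

Lemma outsideE s t u : u != s -> u != t -> outside s t u = ~~ inside s t u.
Proof.
move=> us ut; rewrite insideE // /outside lt_min gt_max.
by move: us ut; case: (ltgtP u s) => // us _; case: (ltgtP u t).
Qed.

Lemma inside_endpoints s t : (inside s t s = false) * (inside s t t = false).
Proof. by rewrite /inside !gt_min !lt_max !ltxx; case: (ltgtP s t). Qed.

Lemma weight_endpoints D i s t x : x = (s, t) \/ x = (t, s) ->
  weight D i s t x = 0.
Proof. by case=> ->; rewrite /weight /= !inside_endpoints. Qed.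

Lemma double_pointC D p q : double_point D p q -> double_point D q p.
Proof. by case=> ? ? ? ?; split=> //; exact: nesym. Qed.

Lemma double_pairsC D i x : double_pairs D i x -> double_pairs D i (x.2, x.1).
Proof. exact: double_pointC. Qed.

Lemma flip_markK : involutive flip_mark. Proof. by case. Qed.

Lemma flat_pairsC D i x : generic_diagram D ->
  flat_pairs D i x -> flat_pairs D i (x.2, x.1).
Proof.
move=> gD [dx mx]; split; first exact: double_pairsC.
by rewrite (generic_mark gD dx) => mV; case: mx; rewrite -[mark _ _ _]flip_markK mV.
Qed.

Lemma double_pairs_finite D i : generic_diagram D -> finite_set (double_pairs D i).
Proof.
move=> gD; apply: sub_finite_set (finite_image
  (fun z : param R n * param R n => (z.1.2, z.2.2)) (generic_finite gD)).
by move=> [u v] duv; exists ((i, u), (i, v)).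
Qed.

(** There is no triple point. *)
Lemma double_pairs_inj D i x y : generic_diagram D ->
  double_pairs D i x -> double_pairs D i y -> x.1 = y.1 -> x = y.
Proof.
move=> gD /double_pointC dx dy xy; rewrite [LHS]surjective_pairing xy.
move: dx; rewrite xy => dx.
by have [->] := generic_no_triple gD dx dy; rewrite -surjective_pairing.
Qed.

(** A flat crossing changes sign when its two strands are exchanged. *)
Lemma weight_swap D i s t : generic_diagram D ->
  \sum_(x \in flat_pairs D i) weight D i s t x
  = - \sum_(x \in flat_pairs D i)
      (if inside s t x.2 && outside s t x.1 then sgn D (i, x.1) (i, x.2) else 0).
Proof.
move=> gD; rewrite (@reindex_fsum _ _ _ (fun x : R * R =>
  (x.2, x.1)) (flat_pairs D i)).
  rewrite -fsumrN; apply: eq_fsbigr => x _; rewrite /weight /=.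
  rewrite (sgn_swap D (i, x.1) (i, x.2)).
  move: (sgn D _ _) => g.
  case: (inside s t x.2 && outside s t x.1).
    by [].
  by rewrite oppr0.
split.
- by move=> x; exact: flat_pairsC.
- by move=> [x1 x2] [y1 y2] _ _ [-> ->].
- move=> [x1 x2] fx; exists (x2, x1) => //; exact: flat_pairsC gD fx.
Qed.

Lemma p_scE D : p_sc D =
  \sum_(i < n) \sum_(c \in self_crossings D i) crossing_term D i c.
Proof. by []. Qed.

Lemma eq_crossing_term D D' i c c' :
  absz (intersection_index D i c.1 c.2) = absz (intersection_index D' i c'.1 c'.2) ->
  sgn D (i, c.1) (i, c.2) = sgn D' (i, c'.1) (i, c'.2) ->
    crossing_term D i c = crossing_term D' i c'.
Proof. exact: (congr2 (fun a b => (tvar i ^+ a - 1) *~ b)). Qed.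

End Index.

(** * Diagrams with corresponding crossings *)

(** A reparametrization P may reverse a component, as recorded by r, and move the
    base point of a circle, as recorded by w: the order of two parameters is
    exchanged when w takes different values there. *)
Section Correspondence.
Local Arguments sgn : simpl never.
Local Opaque sgn.
Variables (R : realType) (n : nat) (D D' : diagram R n) (P : 'I_n -> R -> R).
Hypothesis gD' : generic_diagram D'.
Hypothesis P_double : forall i x, double_pairs D' i x ->
  double_pairs D i (P i x.1, P i x.2).
Hypothesis P_onto : forall i y, double_pairs D i y ->
  exists2 x, double_pairs D' i x & y = (P i x.1, P i x.2).
Hypothesis P_mark : forall i x, double_pairs D' i x ->
  mark D' (i, x.1) (i, x.2) = mark D (i, P i x.1) (i, P i x.2).
Hypothesis P_sgn : forall i x, double_pairs D' i x ->
  sgn D' (i, x.1) (i, x.2) = sgn D (i, P i x.1) (i, P i x.2).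
Hypothesis P_order : forall i, exists (r : bool) (w : R -> bool),
  forall u v, in_domain D' (i, u) -> in_domain D' (i, v) -> u != v ->
    (P i u < P i v) = (u < v) (+) (w u (+) w v (+) r).

Let PP i (x : R * R) := (P i x.1, P i x.2).

Let P_inj i u v : in_domain D' (i, u) -> in_domain D' (i, v) -> P i u = P i v ->
  u = v.
Proof.
move=> du dv e; apply/eqP; apply: contraT => uv.
have [r [w H]] := P_order i.
have := H _ _ du dv uv; have := H _ _ dv du; rewrite eq_sym => /(_ uv).
rewrite e ltxx; move: uv; case: (ltgtP u v) => // _ _;
  by move: (w u) (w v) {H} => [] []; case: r.
Qed.

Let bij_sub i (A A' : set (R * R)) : A' `<=` double_pairs D' i ->
  A `<=` double_pairs D i ->
  (forall x, double_pairs D' i x -> A' x <-> A (PP i x)) -> set_bij A' A (PP i).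
Proof.
move=> sA' sA AA'; split.
- by move=> x A'x; apply/AA' => //; exact: sA'.
- move=> [x1 x2] [y1 y2]; rewrite !inE => /sA'[x1d x2d _ _] /sA'[y1d y2d _ _] [].
  by move=> /P_inj -> // /P_inj ->.
- move=> y Ay; have [x dx yx] := P_onto (sA _ Ay).
  by exists x => //; apply/AA' => //; rewrite /PP -yx.
Qed.

Let P_index i s t : double_pairs D' i (s, t) ->
  absz (intersection_index D i (P i s) (P i t))
  = absz (intersection_index D' i s t).
Proof.
move=> dst; have [r [w H]] := P_order i.
have bij : set_bij (flat_pairs D' i) (flat_pairs D i) (PP i).
  apply: bij_sub => [x []//|x []//|x dx].
  by split=> -[_ m]; split;
    [exact: P_double|rewrite -P_mark|exact: dx|rewrite P_mark].
have ends x : double_pairs D' i x ->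
    [\/ x = (s, t), x = (t, s) | [/\ x.1 != s, x.1 != t, x.2 != s & x.2 != t]].
  move=> dx.
  have [->|x1s] := eqVneq x (s, t); first by constructor 1.
  have [->|x1t] := eqVneq x (t, s); first by constructor 2.
  constructor 3; split; [move: x1s|move: x1t|move: x1t|move: x1s];
  apply: contra => /eqP e; apply/eqP.
  + exact: (double_pairs_inj gD' dx dst e).
  + exact: (double_pairs_inj gD' dx (double_pairsC dst) e).
  + have := double_pairs_inj gD' (double_pairsC dx) dst e.
    by rewrite [X in _ -> X = _]surjective_pairing => -[-> ->].
  + have := double_pairs_inj gD' (double_pairsC dx) (double_pairsC dst) e.
    by rewrite [X in _ -> X = _]surjective_pairing => -[-> ->].
have [ds dt nst _] := dst.
have Pin u : in_domain D' (i, u) -> u != s -> u != t ->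
    inside (P i s) (P i t) (P i u) = inside s t u (+) (w s (+) w t)
    /\ outside (P i s) (P i t) (P i u) = ~~ (inside s t u (+) (w s (+) w t)).
  move=> du us ut.
  have nPs : P i u != P i s by apply: contra us => /eqP /P_inj ->.
  have nPt : P i u != P i t by apply: contra ut => /eqP /P_inj ->.
  rewrite outsideE // !insideE // !H // 1?eq_sym //.
  by move: (w s) (w t) (w u) (s < u) (t < u) {H} => [] [] [] [] []; case: r.
have zero x : x = (s, t) \/ x = (t, s) -> weight D' i s t x = 0 /\
    weight D i (P i s) (P i t) (PP i x) = 0.
  by case=> ->; split; apply: weight_endpoints; [left|left|right|right].
case k: (w s (+) w t).
(* The base point has moved from one part to the other. *)
- apply: absz_eq_or_opp; right.
  apply: etrans (intersection_indexE _ _ _ _) _.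
  apply: etrans (reindex_fsum _ bij) _; apply/esym.
  apply: etrans (congr1 -%R (intersection_indexE _ _ _ _)) _.
  apply: etrans (congr1 -%R (weight_swap i s t gD')) _; rewrite opprK; apply/esym.
  apply: eq_fsbigr => x; rewrite inE => -[dx mx].
  have [xst|xts|[x1s x1t x2s x2t]] := ends _ dx.
  + by have [_ ->] := zero x (or_introl xst); rewrite xst /=;
    rewrite (inside_endpoints s t).2.
  + by have [_ ->] := zero x (or_intror xts); rewrite xts /=;
    rewrite (inside_endpoints s t).1.
  have [d1 d2 _ _] := dx.
  rewrite /weight /= (Pin _ d1 x1s x1t).1 (Pin _ d2 x2s x2t).2 k -P_sgn //.
  by rewrite outsideE // !addbT negbK andbC.
- apply: absz_eq_or_opp; left.
  apply: etrans (intersection_indexE _ _ _ _) _.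
  apply: etrans (reindex_fsum _ bij) _; apply/esym.
  apply: etrans (intersection_indexE _ _ _ _) _; apply/esym.
  apply: eq_fsbigr => x; rewrite inE => -[dx mx].
  have [xst|xts|[x1s x1t x2s x2t]] := ends _ dx.
  + by have [-> ->] := zero x (or_introl xst).
  + by have [-> ->] := zero x (or_intror xts).
  have [d1 d2 _ _] := dx.
  rewrite /weight /= (Pin _ d1 x1s x1t).1 (Pin _ d2 x2s x2t).2 k -P_sgn //.
  by rewrite outsideE // !addbF.
Qed.

Lemma p_sc_correspondence : p_sc D = p_sc D'.
Proof.
rewrite !p_scE; apply: eq_bigr => i _.
have bij : set_bij (self_crossings D' i) (self_crossings D i) (PP i).
  apply: bij_sub => [x []//|x []//|x dx].
  by split=> -[_ m]; split;
    [exact: P_double|rewrite -P_mark|exact: dx|rewrite P_mark].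
apply: etrans (reindex_fsum _ bij) _.
apply: eq_fsbigr => c; rewrite inE => -[dc cm].
apply: eq_crossing_term; first by apply: P_index; case: c dc {cm}.
by apply/esym; exact: P_sgn.
Qed.

End Correspondence.

(** * Planar isotopy *)

Section Isotopy.
Variables (R : realType) (n : nat).
Implicit Types (D : diagram R n) (i : 'I_n).

(** The parameter 1 of an interval is an endpoint, which lies on the boundary of
    the square. *)
Lemma double_param_lt1 D p q : generic_diagram D -> double_point D p q ->
  0 <= p.2 < 1.
Proof.
move=> gD dpq; have [[p0 p1] _ _ _] := dpq; rewrite p0 /=.
case L: (is_loop D p.1) p1 => // p1; rewrite lt_neqAle p1 andbT.
apply/eqP => pe; have ep : is_endpoint D p by split; [|right].
have [_ [e|e]] := generic_endpoint gD ep; have [_] := generic_double_interior gD dpq;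
by rewrite e ltxx ?andbF.
Qed.

Lemma in_domain_ge0_lt1 D i u : 0 <= u < 1 -> in_domain D (i, u).
Proof. by move=> /andP[u0 u1]; split=> //=; case: ifP => // _; exact: ltW. Qed.

Lemma in_domain01 D i u : in_domain D (i, u) -> 0 <= u <= 1.
Proof. by move=> [/= u0]; case: ifP => _ u1; rewrite u0 // ltW. Qed.

Lemma pos_unit_square D p : generic_diagram D -> in_domain D p ->
  unit_square (pos D p).
Proof.
move=> gD dp; case: (pselect (is_endpoint D p)) => [ep|ep].
  by have [h [e|e]] := generic_endpoint gD ep; split=> //; rewrite e ?lexx ?ler01.
have [/andP[/ltW a /ltW b] /andP[/ltW c /ltW d]] := generic_interior gD dp ep.
by split; apply/andP.
Qed.

Lemma derivable_curve D i t : generic_diagram D -> derivable (curve D i) t 1.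
Proof. by move=> gD; have [] := generic_C1 gD i. Qed.

(** The Jacobian at a point of the open square does not vanish during the isotopy
    and is 1 at time 0, so that the final map preserves orientation. *)
Lemma planar_isotopic_p_sc D D' : generic_diagram D -> generic_diagram D' ->
  planar_isotopic D D' -> p_sc D = p_sc D'.
Proof.
move=> gD gD' [loopE [Phi [[dPhi cPhi cdPhi] Phi0 PhiE posE markE]]].
have le01 : 0 <= (1 : R) <= 1 by rewrite ler01 lexx.
have domE p : in_domain D' p <-> in_domain D p by rewrite /in_domain loopE.
have [[Phi_sub Phi_inj Phi_onto] _ _] := PhiE 1 le01.
have dblE p q : double_point D' p q <-> double_point D p q.
  split=> -[dp dq npq]; first (move: dp dq => /domE dp /domE dq).
    rewrite !posE // => e; split=> //; apply: Phi_inj e; rewrite inE;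
      exact: pos_unit_square.
  by move=> e; split; [exact/domE|exact/domE|exact: npq|rewrite !posE // e].
have J1 x : open_unit_square x -> 0 < Defs.jacobian (Phi 1) x.
  move=> ox; have ux : unit_square x.
    by case: ox => /andP[/ltW a /ltW b] /andP[/ltW c /ltW d]; split; apply/andP.
  have d0 v : dplane (Phi 0) x v = v.
    rewrite /dplane -deriveE //; transitivity ('D_v (@id (R * R)) x);
      last exact: derive_id.
    apply: near_eq_derive.
    have near01 (a : R) : 0 < a < 1 -> nbhs a [set y | 0 <= y <= 1].
      move=> a01; apply: filterS (@near_in_itvoo R 0 1 a _) => [y|];
        rewrite in_itv //=.
      by move=> /andP[/ltW -> /ltW ->].
    case: ox => /near01 ox1 /near01 ox2.
    apply: filterS (_ : nbhs x ([set y | 0 <= y <= 1] `*` [set y | 0 <= y <= 1]))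
      => [y []|].
      by move=> y1 y2; apply: Phi0.
    by exists ([set y | 0 <= y <= 1], [set y | 0 <= y <= 1]).
  have cJ : continuous (fun u => Defs.jacobian (Phi u) x).
    apply: (@continuous_jacobian _ _ Phi (fun=> x)) => v u.
    apply: (@continuous_comp _ _ _ (fun u : R => (u, x)) (fun z =>
      dplane (Phi z.1) z.2 v)).
      exact: (cvg_pair cvg_id (cvg_cst _)).
    exact: (cdPhi v (u, x)).
  have nz u : 0 <= u <= 1 -> Defs.jacobian (Phi u) x <> 0 by move=> /PhiE[_ + _];
    apply.
  have J0 : Defs.jacobian (Phi 0) x =
    1 by rewrite /Defs.jacobian !d0 /wedge /= mulr1 mulr0 subr0.
  by have := sgz_nonvanishing cJ ler01 nz; rewrite J0 sgz1 => /esym /eqP;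
    rewrite sgz_cp0.
have velE p q : double_point D p q ->
  velocity D' p = 'd (Phi 1) (pos D p) (velocity D p).
  move=> dpq; have /andP[p0 p1] := double_param_lt1 gD dpq.
  have E := derive1_diff_comp (@derivable_curve D p.1 p.2 gD) (dPhi 1 (pos D p)).
  rewrite -[RHS]E /velocity.
  apply: (@derive1_right_eq _ _ _ _ _ (1 - p.2)).
  - exact: derivable_curve.
  - by apply: derivable_diff_comp => //; exact: derivable_curve.
  - by rewrite subr_gt0.
  - move=> u /andP[pu up]; rewrite /= -(posE (p.1, u)) //.
    apply: in_domain_ge0_lt1; lra.
have sgnE p q : double_point D p q -> sgn D' p q = sgn D p q.
  move=> dpq; have [_ _ _ epq] := dpq.
  rewrite /sgn (velE _ _ dpq) (velE _ _ (double_pointC dpq)) epq wedge_diff //.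
  rewrite sgzM gtr0_sgz ?mul1r // -epq; apply: J1; exact: generic_double_interior dpq.
apply: (@p_sc_correspondence _ _ D D' (fun _ u => u) gD').
- by move=> i [u v] /= /dblE.
- by move=> i [u v] duv; exists (u, v) => //; apply/dblE.
- by move=> i [u v] /dblE duv /=; rewrite markE.
- by move=> i [u v] /dblE duv /=; rewrite sgnE.
- by move=> i; exists false, (fun=> false) => u v _ _ _; rewrite !addbF.
Qed.

End Isotopy.

(** * Reparametrization *)

Section Reparametrization.
Variables (R : realType) (n : nat).
Implicit Types (D : diagram R n) (i : 'I_n).

Lemma C1_monotone (r : R -> R) : C1 r ->
  (forall u, 0 <= u <= 1 -> (r^`() u)%classic <> 0) ->
  exists b : bool,
    (forall u v, 0 <= u <= 1 -> 0 <= v <= 1 -> u != v ->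
      (r u < r v) = (u < v) (+) b) /\
    (forall u v, 0 <= u <= 1 -> 0 <= v <= 1 ->
      0 < (r^`() u)%classic * (r^`() v)%classic).
Proof.
move=> [dr cr] nz.
have sgE u : 0 <= u <= 1 -> sgz (r^`() u)%classic = sgz (r^`() 0)%classic.
  move=> /andP[u0 u1]; apply/esym; apply: sgz_nonvanishing => // x /andP[x0 xu].
  by apply: nz; rewrite x0 (le_trans xu).
have cont : {within `[0, 1], continuous r}.
  apply: continuous_subspaceT => x.
  by apply: differentiable_continuous; apply/derivable1_diffP.
have n0 : (r^`() 0)%classic <> 0 by apply: nz; rewrite lexx ler01.
have prod u v : 0 <= u <= 1 -> 0 <= v <= 1 ->
  0 < (r^`() u)%classic * (r^`() v)%classic.
  move=> u01 v01; rewrite -sgz_cp0 sgzM !sgE //.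
  by move: n0; rewrite sgz_def; case: (ltgtP (r^`() 0)%classic 0) => // -> .
have [p0|p0|/esym//] := ltgtP 0 (r^`() 0)%classic; [exists false|exists true];
  split=> //.
- have H := @gtr0_derive1_incr R r 0 1 (fun x _ => dr x) _ cont.
  have inc x y : 0 <= x -> x < y -> y <= 1 -> r x < r y.
    apply: H => z; rewrite in_itv /= => /andP[/ltW z0 /ltW z1].
    by rewrite -sgz_cp0 sgE ?z0 // sgz_cp0.
  move=> u v /andP[u0 u1] /andP[v0 v1]; rewrite addbF.
  by case: (ltgtP u v) => // uv _; [rewrite inc|rewrite ltNge ltW // inc].
- have H := @ltr0_derive1_decr R r 0 1 (fun x _ => dr x) _ cont.
  have dec x y : 0 <= x -> x < y -> y <= 1 -> r y < r x.
    apply: H => z; rewrite in_itv /= => /andP[/ltW z0 /ltW z1].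
    by rewrite -sgz_cp0 sgE ?z0 // sgz_cp0.
  move=> u v /andP[u0 u1] /andP[v0 v1]; rewrite addbT.
  by case: (ltgtP u v) => // uv _; [rewrite ltNge ltW // dec|rewrite dec].
Qed.

(** Reduction modulo 1 exchanges the order of two parameters when one of them, but
    not the other, is separated from c by an integer. *)
Lemma wrap_lt (a b c : R) : `|a - b| < 1 -> a != b ->
  (c <= a < c + 1 /\ c <= b < c + 1) \/ (c - 1 < a <= c /\ c - 1 < b <= c) ->
  (Defs.wrap true a < Defs.wrap true b) =
    (a < b) (+) ((Num.floor a != Num.floor c) (+) (Num.floor b != Num.floor c)).
Proof.
have le_int (x y : int) : (x%:~R : R) < y%:~R + 1 -> x <= y.
  by move=> h; rewrite -ltzD1 -(ltr_int R) rmorphD.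
move=> ab1 nab abc; rewrite /Defs.wrap.
have /andP[a1 a2] := floor_itv a; have /andP[b1 b2] := floor_itv b.
have /andP[c1 c2] := floor_itv c; rewrite !rmorphD /= in a2 b2 c2.
move: ab1; rewrite ltr_norml => /andP[ab1 ab2].
set x := Num.floor a in a1 a2 *; set y := Num.floor b in b1 b2 *.
set z := Num.floor c in c1 c2 *.
have bound : (z <= x <= z + 1 /\ z <= y <= z + 1) \/
             (z - 1 <= x <= z /\ z - 1 <= y <= z).
  by case: abc => -[/andP[? ?] /andP[? ?]]; [left|right];
    split; apply/andP; split; apply: le_int; rewrite ?(rmorphD, rmorphB) /=; lra.
have [xy|xy|xy] := ltgtP x y.
- have xyR : (x%:~R : R) + 1 <= y%:~R by rewrite -intrD1 ler_int lezD1.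
  have -> : (a < b) = true by lra.
  have -> : (a - x%:~R < b - y%:~R) = false by apply/negbTE; lra.
  by case: bound => -[]; clear -xy; lia.
- have xyR : (y%:~R : R) + 1 <= x%:~R by rewrite -intrD1 ler_int lezD1.
  have -> : (a < b) = false by apply/negbTE; lra.
  have -> : (a - x%:~R < b - y%:~R) = true by lra.
  by case: bound => -[]; clear -xy; lia.
- by rewrite xy addbb addbF ltrD2r.
Qed.

Lemma wrapDz (a : R) (m : int) : 0 <= a < 1 -> Defs.wrap true (a + m%:~R) = a.
Proof.
move=> /andP[a0 a1]; rewrite /Defs.wrap (@floor_def _ _ m) ?addrK //.
by rewrite rmorphD /= lerDr a0 addrC ltrD2l a1.
Qed.

Lemma wrap_itv (a : R) : 0 <= Defs.wrap true a < 1.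
Proof.
rewrite /Defs.wrap; have /andP[] := floor_itv a; rewrite rmorphD /= => *.
by apply/andP; split; lra.
Qed.

Lemma periodicZ (T : Type) (f : R -> T) : (forall t, f (t + 1) = f t) ->
  forall t (m : int), f (t + m%:~R) = f t.
Proof.
move=> f1; have N t (k : nat) : f (t + k%:R) = f t.
  by elim: k => [|k IH]; rewrite ?addr0 // -natr1 addrA f1.
move=> t [k|k]; first exact: N.
by rewrite NegzE mulrNz -(N _ k.+1) subrK.
Qed.

Lemma curve_wrap D i t : generic_diagram D ->
  curve D i (Defs.wrap (is_loop D i) t) = curve D i t /\
  ((curve D i)^`() (Defs.wrap (is_loop D i) t))%classic = ((curve D i)^`() t)%classic.
Proof.
move=> gD; rewrite /Defs.wrap; case L: (is_loop D i); last by [].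
have per u m : curve D i (u + m%:~R) = curve D i u.
  by apply: periodicZ => {u m} u; exact: (generic_periodic gD _ L).
set m := Num.floor t.
have -> : t - m%:~R = t + (- m)%:~R by rewrite mulrNz.
split; first exact: per.
rewrite -(derive1_shift (derivable_curve gD)).
have E : (fun u => curve D i (u + (- m)%:~R)) = curve D i by apply/funext => u;
  exact: per.
by rewrite E.
Qed.

(** The derivative of the change of parameter has a constant sign on a component,
    so that the two velocities at a self-crossing are both reversed or neither. *)
Lemma reparametrized_p_sc D D' : generic_diagram D -> generic_diagram D' ->
  reparametrized D D' -> p_sc D = p_sc D'.
Proof.
move=> gD gD' [loopE [rho [C1rho rho_dom rho_end posE markE]]].
have domE p : in_domain D' p <-> in_domain D p by rewrite /in_domain loopE.
pose P i u := Defs.wrap (is_loop D i) (rho i u).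
have drho i u : derivable (rho i) u 1 by have [] := C1rho i.
have nz i u : 0 <= u <= 1 -> ((rho i)^`() u)%classic <> 0.
  move=> /andP[u0]; rewrite le_eqVlt => /orP[/eqP -> {u u0}|u1]; last first.
    by apply: (rho_dom (i, u)); apply: in_domain_ge0_lt1; rewrite u0.
  have := rho_end i; case L: (is_loop D i); last first.
    by move=> _; apply: (rho_dom (i, 1)); split=> //=; rewrite L.
  move=> per; suff -> : ((rho i)^`() 1)%classic = ((rho i)^`() 0)%classic.
    by apply: (rho_dom (i, 0)); apply: in_domain_ge0_lt1; rewrite lexx /=.
  have E := derive1_shift (drho i (0 + 1)).
  rewrite add0r in E; rewrite -E.
  case: per => per.
    have -> : (fun u => rho i (u + 1)) = (fun u => rho i u + 1).
      by apply/funext => u; exact: per.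
    exact: (@derive1_addr R _ (rho i) 1 0 (drho i 0)).2.
  have -> : (fun u => rho i (u + 1)) = (fun u => rho i u - 1).
    by apply/funext => u; exact: per.
  exact: (@derive1_addr R _ (rho i) (- 1) 0 (drho i 0)).2.
have velE p q : double_point D' p q -> 0 <= p.2 <= 1 /\
    velocity D' p = ((rho p.1)^`() p.2)%classic *: velocity D (p.1, P p.1 p.2).
  move=> dpq; have /andP[p0 p1] := double_param_lt1 gD' dpq.
  split; first by rewrite p0 ltW.
  have E := derive1_scalar_comp (@derivable_curve _ _ D p.1 (rho p.1 p.2) gD)
    (drho p.1 p.2).
  rewrite /velocity (@curve_wrap D p.1 (rho p.1 p.2) gD).2 -[RHS]E.
  apply: (@derive1_right_eq _ _ _ _ _ (1 - p.2)).
  - exact: derivable_curve.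
  - apply/derivable1_diffP/differentiable_comp; apply/derivable1_diffP => //.
    exact: derivable_curve.
  - by rewrite subr_gt0.
  - move=> u /andP[pu up]; rewrite /= -(posE (p.1, u)) //.
    apply: in_domain_ge0_lt1; lra.
have Ppos i u : in_domain D (i, u) -> pos D' (i, u) = pos D (i, P i u).
  by move=> du; rewrite posE // /pos /= (@curve_wrap D i (rho i u) gD).1.
have rho1 i : rho i 1 = rho i 0 + 1 \/ rho i 1 = rho i 0 - 1.
  have := rho_end i; case: (is_loop D i).
    by case=> per; [left|right]; rewrite -[in LHS](add0r 1) per.
  by case=> -[-> ->]; [left|right]; rewrite ?add0r ?subrr.
have i01 : (0 <= (0 : R) <= 1) * (0 <= (1 : R) <= 1) by rewrite !lexx ler01.
have rho_bound i u : 0 <= u <= 1 ->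
   (rho i 1 = rho i 0 + 1 /\ rho i 0 <= rho i u <= rho i 0 + 1) \/
   (rho i 1 = rho i 0 - 1 /\ rho i 0 - 1 <= rho i u <= rho i 0).
  move=> u01; have [b [mono _]] := C1_monotone (C1rho i) (nz i).
  have m01 := mono 0 1 i01.1 i01.2; rewrite eq_sym oner_neq0 ltr01 in m01.
  have [->|u0] := eqVneq u 0; first by case: (rho1 i) => e; [left|right];
    split=> //; lra.
  have [->|u1] := eqVneq u 1; first by case: (rho1 i) => e; [left|right];
    split=> //; lra.
  have := mono u 0 u01 i01.1 u0; have := mono u 1 u01 i01.2 u1; have := m01 isT.
  have -> : (u < 1) = true by rewrite lt_neqAle u1; lra.
  have -> : (u < 0) = false by lra.
  by case: b {mono m01} => /=; case: (rho1 i) => e; [right|right|left|left];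
    split=> //; lra.
have Pdom i u : in_domain D (i, u) -> in_domain D (i, P i u).
  move=> du; rewrite /P; case L: (is_loop D i).
    by apply: in_domain_ge0_lt1; exact: wrap_itv.
  have u01 := in_domain01 du.
  rewrite /Defs.wrap /in_domain /= L; have := rho_end i; rewrite L.
  by case: (rho_bound i u u01) => -[-> /andP[h1 h2]] [[e0 e1]|[e0 e1]];
    rewrite e0 in h1 h2 e1 *; lra.
have Ponto i v : in_domain D (i, v) -> exists2 u, in_domain D (i, u) & P i u = v.
  move=> dv; have v01 := in_domain01 dv.
  have onto y : Num.min (rho i 0) (rho i 1) <= y <= Num.max (rho i 0) (rho i 1) ->
      exists2 u, 0 <= u <= 1 & rho i u = y.
    move=> /(IVT ler01)[|u]; last by rewrite in_itv /=; exists u.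
    apply: continuous_subspaceT => x.
    by apply: differentiable_continuous; apply/derivable1_diffP.
  rewrite /P; case L: (is_loop D i); last first.
    have [|u u01 uv] := onto v.
      by rewrite ge_min le_max; have := rho_end i; rewrite L => -[[-> ->]|[-> ->]];
        lra.
    by exists u => //; split; rewrite /= ?L; lra.
  have v1 : 0 <= v < 1 by move: dv => [/= v0]; rewrite L v0.
  have [m vm] : exists m : int, (rho i 1 = rho i 0 + 1 /\
      rho i 0 <= v + m%:~R < rho i 0 + 1) \/
      (rho i 1 = rho i 0 - 1 /\ rho i 0 - 1 < v + m%:~R <= rho i 0).
    case: (rho1 i) => e.
      exists (Num.ceil (rho i 0 - v)); left; split => //.
      by have := ceil_itv (rho i 0 - v); rewrite rmorphB /=; lra.
    exists (Num.floor (rho i 0 - v)); right; split => //.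
    by have := floor_itv (rho i 0 - v); rewrite rmorphD /=; lra.
  have [|u u01 uv] := onto (v + m%:~R).
    by rewrite ge_min le_max; case: vm => -[-> ?]; lra.
  exists u; last by rewrite uv wrapDz.
  apply: in_domain_ge0_lt1; move: u01 => /andP[-> /=].
  rewrite le_eqVlt => /orP[/eqP u1|//]; move: vm; rewrite -uv u1.
  by case=> -[->]; lra.
have Porder i : exists (r : bool) (w : R -> bool),
    forall u v, in_domain D' (i, u) -> in_domain D' (i, v) -> u != v ->
    (P i u < P i v) = (u < v) (+) (w u (+) w v (+) r).
  have [b [mono _]] := C1_monotone (C1rho i) (nz i).
  rewrite /P; case L: (is_loop D i); last first.
    exists b, (fun=> false) => u v /domE/in_domain01 du /domE/in_domain01 dv uv.
    exact: mono.
  exists b, (fun u => Num.floor (rho i u) != Num.floor (rho i 0)).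
  move=> u v /domE du /domE dv uv.
  have strict x : in_domain D (i, x) ->
     0 <= x <= 1 /\
     ((rho i 1 = rho i 0 + 1 /\ rho i 0 <= rho i x < rho i 0 + 1) \/
     (rho i 1 = rho i 0 - 1 /\ rho i 0 - 1 < rho i x <= rho i 0)).
    move=> dx; have x01 := in_domain01 dx; split=> //.
    have x1 : x != 1 by move: dx => [_ /=]; rewrite L => /lt_eqF ->.
    have : rho i x != rho i 1.
      apply/eqP => e; have := mono _ _ x01 i01.2 x1.
      have := mono _ _ i01.2 x01; rewrite eq_sym => /(_ x1).
      rewrite e ltxx; move: x1; case: (ltgtP x 1) => // _ _; by case: (b).
    case: (rho_bound i x x01) => -[-> h] n1; [left|right]; split=> //; move: n1.
      by rewrite neq_lt; lra.
    by rewrite neq_lt; lra.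
  have [u01 su] := strict u du; have [v01 sv] := strict v dv.
  have nuv : rho i u != rho i v.
    apply/eqP => e; have := mono _ _ u01 v01 uv.
    have := mono _ _ v01 u01; rewrite eq_sym => /(_ uv).
    rewrite e ltxx; move: uv; case: (ltgtP u v) => // _ _; by case: (b).
  rewrite (@wrap_lt _ _ (rho i 0)) //; last 2 first.
  - by rewrite ltr_norml; move: su sv => [[-> ?]|[-> ?]] [[? ?]|[? ?]]; lra.
  - by move: su sv => [[-> ?]|[-> ?]] [[? ?]|[? ?]];
    [left|exfalso; lra|exfalso; lra|right].
  by rewrite mono // -!addbA [b (+) _]addbC -!addbA.
have Pinj i u v : in_domain D' (i, u) -> in_domain D' (i, v) -> P i u = P i v ->
  u = v.
  move=> du dv e; apply/eqP; apply: contraT => uv.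
  have [r [w H]] := Porder i.
  have := H _ _ du dv uv; have := H _ _ dv du; rewrite eq_sym => /(_ uv).
  rewrite e ltxx; move: uv; case: (ltgtP u v) => // _ _;
    by move: (w u) (w v) => [] []; case: (r).
apply: (@p_sc_correspondence _ _ D D' P gD').
- move=> i [u v] [du dv nuv epos] /=; split; rewrite /=.
  + by apply: Pdom; apply/domE.
  + by apply: Pdom; apply/domE.
  + by move=> [] /Pinj e; apply: nuv; rewrite e.
  + by rewrite -!Ppos //; apply/domE.
- move=> i [u v] [/Ponto[u' du' eu] /Ponto[v' dv' ev] nuv epos].
  exists (u', v') => /=; last by rewrite eu ev.
  split; [exact/domE|exact/domE| |].
  + by move=> [] e; apply: nuv; rewrite -eu -ev /= e.
  + by rewrite /= !Ppos // eu ev.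
- by move=> i [u v] duv; exact: markE.
- move=> i [u v] duv; have [u01 vu] := velE _ _ duv.
  have [v01 vv] := velE _ _ (double_pointC duv).
  have [b [_ pr]] := C1_monotone (C1rho i) (nz i).
  by rewrite /sgn vu vv wedgeZ sgzM gtr0_sgz ?mul1r // pr.
- exact: Porder.
Qed.

End Reparametrization.

(** * Resolution of double points *)

Section FiniteType.
Variables (R : realType) (n : nat).
Implicit Types (D : diagram R n) (i : 'I_n) (d : param R n * param R n).

Lemma sgn_resolve D d b p q : sgn (resolve D d b) p q = sgn D p q.
Proof. by []. Qed.

Lemma sgn_double D p q : generic_diagram D -> double_point D p q ->
  sgn D p q = if 0 < sgn D p q then 1 else -1.
Proof.
move=> gD /(generic_transverse gD); rewrite /sgn sgz_def.
by case: (ltgtP (wedge _ _) 0) => // -> .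
Qed.

Local Opaque sgn.

Lemma generic_resolve D d b : generic_diagram D -> double_point D d.1 d.2 ->
  generic_diagram (resolve D d b).
Proof.
move=> [? ? ? ? ? ? ? ? ? mk] dd; constructor => // p q dpq.
have npq : p <> q by case: dpq.
rewrite /resolve /=; set m := if _ == b then _ else _.
have [e|ne] := eqVneq (p, q) d; have [e'|ne'] := eqVneq (q, p) d => //.
- by move: e'; rewrite -e => -[/esym].
- by rewrite flip_markK.
- exact: mk.
Qed.

(** Singular, over and under crossings are all flat crossings. *)
Lemma flat_pairs_resolve D d b i : generic_diagram D -> singular_point D d.1 d.2 ->
  flat_pairs (resolve D d b) i = flat_pairs D i.
Proof.
move=> gD [dd md]; have md' := generic_mark gD dd; rewrite md /= in md'.
apply/seteqP; split => -[x y] [dxy]; rewrite /resolve /= => mxy; split=> //=;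
  move: mxy; set m := if _ == b then _ else _;
  have [e|ne] := eqVneq (_, _) d; rewrite -?e /= in md md'.
- by rewrite md.
- by have [e|ne'] := eqVneq (_, _) d; rewrite -?e /= in md md' *; rewrite ?md'.
- by move=> _; rewrite /m; case: ifP.
- by have [e|ne'] := eqVneq (_, _) d => // _; rewrite /m; case: ifP.
Qed.

Lemma index_resolve D d b i s t : generic_diagram D -> singular_point D d.1 d.2 ->
  intersection_index (resolve D d b) i s t = intersection_index D i s t.
Proof.
move=> gD sd; apply: etrans (intersection_indexE _ _ _ _) _.
apply/esym; apply: etrans (intersection_indexE _ _ _ _) _.
by rewrite flat_pairs_resolve.
Qed.

(** The summand of d in the polynomial, with a prescribed sign e. *)
Definition smoothing_term D i d (e : int) : mpoly n int :=
  (tvar i ^+ `|intersection_index D i d.1.2 d.2.2|%N - 1) *~ e.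

Definition resolution_term D d b : mpoly n int :=
  \sum_(i < n) if (d.1.1 == i) && (d.2.1 == i)
    then smoothing_term D i d (if b then 1 else -1) else 0.

(** The old terms are unchanged because their indices are, and [resolve] chooses
    the upper strand so that the new crossing has the sign b. *)
Lemma p_sc_resolve D d b : generic_diagram D -> singular_point D d.1 d.2 ->
  p_sc (resolve D d b) = p_sc D + resolution_term D d b.
Proof.
move=> gD sd; have [dd md] := sd; have md' := generic_mark gD dd;
  rewrite md /= in md'.
have gD' := generic_resolve b gD dd.
rewrite !p_scE /resolution_term -big_split /=; apply: eq_bigr => i _.
have termE c : crossing_term (resolve D d b) i c = crossing_term D i c.
  by apply: eq_crossing_term; [rewrite index_resolve|exact: sgn_resolve].
case: ifPn => [/andP[/eqP d1i /eqP d2i]|nd].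
  pose o := (0 < sgn D d.1 d.2) == b.
  pose c : R * R := if o then (d.1.2, d.2.2) else (d.2.2, d.1.2).
  have dE : ((i, d.1.2), (i, d.2.2)) = d by move: d1i d2i;
    case: (d) => -[? ?] [? ?] /= -> ->.
  have dd1 : double_point D (i, d.1.2) (i, d.2.2) by move: dd; rewrite -{1 2}dE.
  have m1 : mark D (i, d.1.2) (i, d.2.2) = Singular by move: md; rewrite -{1 2}dE.
  have m2 : mark D (i, d.2.2) (i, d.1.2) = Singular by move: md'; rewrite -{1 2}dE.
  have nE : ((i, d.2.2), (i, d.1.2)) != d.
    apply/eqP => e; case: dd1 => _ _ []; rewrite -dE in e; by case: e => ->.
  have markE x y : mark (resolve D d b) x y = if (x, y) == d
      then (if o then Over else Under) else if (y, x) == d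
      then (if o then Under else Over) else mark D x y.
    by rewrite /resolve /= -/o; case: (o).
  have c_double : double_pairs D i c.
    by rewrite /c; case: (o); [exact: dd1|exact: double_pointC].
  have c_self : self_crossings (resolve D d b) i c.
    split; first exact: c_double.
    rewrite markE /c; case oE: o => /=; first by rewrite dE eqxx.
    by rewrite (negPf nE) dE eqxx.
  have c_unique c' : self_crossings (resolve D d b) i c' -> c' <> c ->
      self_crossings D i c'.
    move=> [dc' mc'] nc; split=> //; move: mc' nc; rewrite markE.
    case: c' dc' => x y dc' /=; have [e|ne] := eqVneq (_, _) d.
      by rewrite /c -e /=; case: (o).
    have [e|ne'] := eqVneq (_, _) d => //.
    by rewrite /c -e /=; case: (o).
  have c_old c' : self_crossings D i c' ->
      self_crossings (resolve D d b) i c' /\ c' <> c.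
    move=> [dc' mc']; split; last first.
      by move=> e; move: mc'; rewrite e /c; case: (o) => /=; rewrite ?m1 ?m2.
    split=> //; rewrite markE; case: c' dc' mc' => x y dc' /= mc'.
    have [e|ne] := eqVneq (_, _) d.
      by move: mc' md; rewrite -e /= => ->.
    have [e|ne'] := eqVneq (_, _) d => //.
    by move: mc' md'; rewrite -e /= => ->.
  have fin : finite_set (self_crossings (resolve D d b) i).
    by apply: sub_finite_set (double_pairs_finite i gD') => x [].
  apply: etrans (fsumD1 _ fin c_self) _; apply: etrans (addrC _ _) _.
  apply: (congr2 (fun a b => a + b)).
    apply: eq_fsumr => [|x _]; last exact: termE.
    apply/seteqP; split => x; first by case=> ? ?; exact: c_unique.
    by move=> /c_old[].
  rewrite termE; apply: (congr2 (fun k e => (tvar i ^+ `|k|%N - 1) *~ e)).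
    by rewrite /c; case: (o) => //=; exact: intersection_indexC.
  have sd1 := sgn_double gD dd; rewrite -{1 2}dE in sd1.
  rewrite /c /o; move: sd1; case: (ltP 0 (sgn D _ _)) => _ sd1.
    by case: (b) => /=; [exact: sd1|rewrite sgn_swap sd1].
  by case: (b) => /=; [rewrite sgn_swap sd1 opprK|exact: sd1].
apply: etrans (esym (addr0 _)); 
apply: eq_fsumr => [|x _]; last exact: termE.
apply/seteqP; split => -[x y] [dc]; rewrite /resolve /= => mc; split=> //=;
  move: mc; rewrite (negPf (_ : (i, x, (i, y)) != d))
    1?(negPf (_ : (i, y, (i, x)) != d)) //;
  by apply: contra nd => /eqP <-; rewrite /= eqxx.
Qed.

(** The term that d contributes is the same in both resolutions of d2, since it is
    determined by the flat diagram. *)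
Lemma extend_p_sc_eq0 ds D : generic_diagram D -> uniq ds ->
  (forall d, d \in ds -> singular_point D d.1 d.2) ->
  (forall d, d \in ds -> (d.2, d.1) \notin ds) ->
  (1 < size ds)%N -> extend (@p_sc R n) D ds = 0.
Proof.
elim: ds D => // d [//|d2 ds] IH D gD /=/andP[nd uds] sing asym _.
have sd := sing d (mem_head _ _).
have sing' b d' : d' \in d2 :: ds -> singular_point (resolve D d b) d'.1 d'.2.
  move=> d'ds; have [dd' md'] := sing d' (mem_behead (s := d :: _) d'ds).
  split=> //=; rewrite -surjective_pairing.
  case: eqP => [e|_]; first by move: nd; rewrite -e d'ds.
  case: eqP => [e|//]; have := asym d (mem_head _ _).
  by rewrite -e /= -surjective_pairing inE d'ds orbT.
case: ds => [|d3 ds] in IH nd uds sing asym sing' *.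
  have s2 := sing d2; rewrite !inE eqxx orbT in s2; have {}s2 := s2 isT.
  have s2' b := sing' b d2 (mem_head _ _).
  have gD' b := generic_resolve b gD sd.1.
  rewrite /= !p_sc_resolve //.
  have E b b' : resolution_term (resolve D d b) d2 b' = resolution_term D d2 b'.
    by apply: eq_bigr => i _; rewrite /smoothing_term index_resolve.
  rewrite !E; ring.
have Z b : extend (@p_sc R n) (resolve D d b) [:: d2, d3 & ds] = 0.
  apply: IH => //; first by apply: generic_resolve => //; exact: sd.1.
  - by move=> d' d'ds; exact: sing'.
  - move=> d' d'ds; have := asym d' (mem_behead (s := d :: _) d'ds).
    by rewrite inE negb_or => /andP[].
by apply: etrans (subr0 _); congr (_ - _); exact: Z.
Qed.

End FiniteType.

(** * Changes inside a disc *)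

Section LocalChange.
Variables (R : realType) (n k : nat) (phi : R * R -> R * R).
Variables (S : 'I_k -> strand R n) (sigma sigma' : 'I_k -> R -> R * R).
Variables (D D' : diagram R n).
Hypotheses (gD : generic_diagram D) (gD' : generic_diagram D').
Hypothesis change : local_change phi S sigma sigma' D D'.

Definition on_strands (p : param R n) : Prop := exists a, on_strand (S a) p.

Let loopE i : is_loop D' i = is_loop D i.
Proof. by have [[]] := change. Qed.

Let domE p : in_domain D' p <-> in_domain D p.
Proof. by rewrite /in_domain loopE. Qed.

Let S_ok a : strand_ok (S a).
Proof. by have [_ []] := change. Qed.

Let posE p : in_domain D p -> ~ on_strands p -> pos D' p = pos D p.
Proof.
have [_ _ _ _ [h _ _] dp np] := change; apply: h => // a Sa.
by apply: np; exists a.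
Qed.

Lemma on_strandsP (E : diagram R n) p : E = D \/ E = D' -> in_domain E p ->
  on_strands p <-> (phi @` @model_box R) (pos E p).
Proof.
move=> ED dp; have [_ _ inE arcs _] := change; split; last exact: inE.
case: p {dp} => i t [a [/= -> tS]]; have [bs bs' c c'] := arcs a t tS.
by case: ED => ->; rewrite /pos /= ?c ?c'; [exists (sigma a t)|exists (sigma' a t)].
Qed.

Lemma on_strandsC (E : diagram R n) p q : E = D \/ E = D' -> double_point E p q ->
  on_strands p <-> on_strands q.
Proof. by move=> ED [dp dq _ e]; rewrite !(on_strandsP ED) // e. Qed.

Let off_right i t : ~ on_strands (i, t) ->
  exists2 e, 0 < e & forall u, t <= u < t + e -> ~ on_strands (i, u).
Proof.
move=> off; pose f a := if t < strand_lo (S a) then strand_lo (S a) - t else 1.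
exists (\big[Num.min/1]_(a < k) f a).
  elim/big_ind: _ => [|x y x0 y0|a _]; rewrite ?ltr01 ?lt_min ?x0 //.
  by rewrite /f; case: ifP => // ta; rewrite subr_gt0.
move=> u /andP[tu ut] [a [/= ia /andP[lu uh]]].
have : u < t + f a by apply: lt_le_trans ut _; rewrite lerD2l; exact: bigmin_le_cond.
rewrite /f; case: (ltP t _) => [_|lt _]; first by move=> ?; lra.
by apply: off; exists a; split=> //=; rewrite lt (le_trans tu).
Qed.

Let vel_off p q : double_point D p q -> ~ on_strands p ->
  velocity D' p = velocity D p.
Proof.
case: p => i t dpq off; have /andP[/= t0 t1] := double_param_lt1 gD dpq.
have [e e0 H] := off_right off.
apply: (@derive1_right_eq _ _ _ _ _ (Num.min e (1 - t))).
- exact: derivable_curve.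
- exact: derivable_curve.
- by rewrite lt_min e0 subr_gt0.
- move=> u /andP[tu ut].
  have /andP[ue u1] : (u - t < e) && (u - t < 1 - t) by rewrite -lt_min ltrBlDl.
  apply: (@posE (i, u)).
    by apply: in_domain_ge0_lt1; rewrite (le_trans t0 tu) -(ltrD2r (- t)).
  by apply: H; rewrite tu -ltrBlDl.
Qed.

Let dbl_off p q : ~ on_strands p -> double_point D p q <-> double_point D' p q.
Proof.
move=> off; split=> dpq; have := dpq => -[dp dq npq e].
  have offq : ~ on_strands q by move=> /(on_strandsC (or_introl erefl) dpq).
  by split; [exact/domE|exact/domE|exact: npq|rewrite !posE].
have offq : ~ on_strands q by move=> /(on_strandsC (or_intror erefl) dpq).
move/domE: dp => dp; move/domE: dq => dq.
by split=> //; rewrite -!posE.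
Qed.

Let mark_off p q : double_point D p q -> ~ on_strands p ->
  mark D' p q = mark D p q.
Proof.
move=> dpq off; have [_ _ _ _ [_ _ h]] := change; apply: h => // a Sa.
  by apply: off; exists a.
by apply: off; apply/(on_strandsC (or_introl erefl) dpq); exists a.
Qed.

Let sgn_off p q : double_point D p q -> ~ on_strands p ->
  sgn D' p q = sgn D p q.
Proof.
move=> dpq off; rewrite /sgn (vel_off dpq off) (vel_off (double_pointC dpq)) //.
by move=> /(on_strandsC (or_introl erefl) dpq).
Qed.

Definition strand_pairs (i : 'I_n) : set (R * R) := [set x | on_strands (i, x.1)].

(** Off the strands the two diagrams coincide, so that only the partition of the
    parameters by the smoothed crossing matters. *)
Lemma outer_weights i s t s' t' :
  (forall u, ~ on_strands (i, u) ->
     inside s t u = inside s' t' u /\ outside s t u = outside s' t' u) ->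
  \sum_(x \in flat_pairs D i `&` ~` strand_pairs i) weight D i s t x =
  \sum_(x \in flat_pairs D' i `&` ~` strand_pairs i) weight D' i s' t' x.
Proof.
move=> same; apply: eq_fsumr => [|x [[dx mx] off]].
  apply/seteqP; split=> x [[dx mx] off]; split=> //; split.
  - exact/dbl_off.
  - by rewrite mark_off.
  - exact/dbl_off.
  - by rewrite -mark_off //; apply/dbl_off.
have {}dx : double_point D (i, x.1) (i, x.2) by exact/dbl_off.
have offq : ~ on_strands (i, x.2).
  by move=> /(on_strandsC (or_introl erefl) dx).
have [e1 _] := same _ off; have [_ e2] := same _ offq.
by rewrite /weight e1 e2 sgn_off.
Qed.

Lemma outer_weights_self i s t s' t' :
  (forall u, ~ on_strands (i, u) ->
     inside s t u = inside s' t' u /\ outside s t u = outside s' t' u) ->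
  \sum_(x \in flat_pairs D i `&` ~` strand_pairs i) weight D i s t x =
  \sum_(x \in flat_pairs D i `&` ~` strand_pairs i) weight D i s' t' x.
Proof.
move=> same; apply: eq_fsumr => // x [[dx mx] off].
have offq : ~ on_strands (i, x.2).
  by move=> /(on_strandsC (or_introl erefl) dx).
have [e1 _] := same _ off; have [_ e2] := same _ offq.
by rewrite /weight e1 e2.
Qed.

Lemma index_split (E : diagram R n) i s t : generic_diagram E ->
  intersection_index E i s t =
  \sum_(x \in flat_pairs E i `&` strand_pairs i) weight E i s t x +
  \sum_(x \in flat_pairs E i `&` ~` strand_pairs i) weight E i s t x.
Proof.
move=> gE; apply: etrans (intersection_indexE _ _ _ _) _.
apply: fsumID; apply: sub_finite_set (double_pairs_finite i gE).
by move=> x [].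
Qed.

(** By the first condition the crossings inside the disc have the same total effect
    on the index of every crossing outside, whose term is then unchanged; by the
    second one the terms of the crossings inside have the same sum. *)
Lemma local_p_sc :
  (forall i s t, ~ on_strands (i, s) -> ~ on_strands (i, t) ->
    \sum_(x \in flat_pairs D i `&` strand_pairs i) weight D i s t x =
    \sum_(x \in flat_pairs D' i `&` strand_pairs i) weight D' i s t x) ->
  (forall i, \sum_(c \in self_crossings D i `&` strand_pairs i) crossing_term D i c =
    \sum_(c \in self_crossings D' i `&` strand_pairs i) crossing_term D' i c) ->
  p_sc D = p_sc D'.
Proof.
move=> Hout Hin; rewrite !p_scE; apply: eq_bigr => i _.
have fin (E : diagram R n) : generic_diagram E -> finite_set (self_crossings E i).
  by move=> gE; apply: sub_finite_set (double_pairs_finite i gE) => x [].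
have E1 := @fsumID _ _ (strand_pairs i) _ (crossing_term D i) (fin D gD).
apply: etrans E1 _.
apply/esym; have E2 := @fsumID _ _ (strand_pairs i) _ (crossing_term D' i)
  (fin D' gD').
apply: etrans E2 _; apply/esym.
apply: (congr2 (fun a b => a + b)); first exact: Hin.
apply: eq_fsumr => [|c [[dc mc] off]].
  apply/seteqP; split=> x [[dx mx] off]; split=> //; split.
  - exact/dbl_off.
  - by rewrite mark_off.
  - exact/dbl_off.
  - by rewrite -mark_off //; apply/dbl_off.
have {}dc : double_point D (i, c.1) (i, c.2) by exact/dbl_off.
have offq : ~ on_strands (i, c.2).
  by move=> /(on_strandsC (or_introl erefl) dc).
apply: eq_crossing_term; last by rewrite sgn_off.
apply: (congr1 absz); apply: etrans (index_split _ _ _ gD) _.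
apply/esym; apply: etrans (index_split _ _ _ gD') _; apply/esym.
apply: (congr2 (fun a b => a + b)); first exact: Hout.
exact: outer_weights.
Qed.

(** A strand that contains neither s nor t lies in one part. *)
Lemma same_strand_inside i s t a u v :
  ~ on_strands (i, s) -> ~ on_strands (i, t) ->
  on_strand (S a) (i, u) -> on_strand (S a) (i, v) ->
  inside s t u = inside s t v /\ outside s t u = ~~ inside s t v.
Proof.
move=> offs offt [/= ia /andP[lu uh]] [/= _ /andP[lv vh]].
have side r : ~ on_strands (i, r) -> [/\ u != r, v != r & (r < u) = (r < v)].
  move=> off; have out : r < strand_lo (S a) \/ strand_hi (S a) < r.
    case: (ltP r (strand_lo (S a))) => [|lr]; [by left|right].
    rewrite ltNge; apply/negP => rh; apply: off; exists a; split=> //=.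
    by rewrite lr.
  by clear ia off; case: out => r_out; split; lra.
have [us vs sE] := side s offs; have [ut vt tE] := side t offt.
by rewrite outsideE // !insideE // sE tE.
Qed.

(** Moving s or t along a strand does not affect the parameters off the strands. *)
Lemma same_strand_outer i s t s' t' a b u :
  on_strand (S a) (i, s) -> on_strand (S a) (i, s') ->
  on_strand (S b) (i, t) -> on_strand (S b) (i, t') -> ~ on_strands (i, u) ->
  inside s t u = inside s' t' u /\ outside s t u = outside s' t' u.
Proof.
move=> As As' Bt Bt' off.
have side c r r' : on_strand (S c) (i, r) -> on_strand (S c) (i, r') ->
    [/\ u != r, u != r' & (r < u) = (r' < u)].
  move=> [/= ic /andP[lr rh]] [/= _ /andP[lr' rh']].
  have out : u < strand_lo (S c) \/ strand_hi (S c) < u.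
    case: (ltP u (strand_lo (S c))) => [|lu]; [by left|right].
    rewrite ltNge; apply/negP => uh; apply: off; exists c; split=> //=.
    by rewrite lu.
  by clear ic off; case: out => r_out; split; lra.
have [us us' sE] := side _ _ _ As As'; have [ut ut' tE] := side _ _ _ Bt Bt'.
by rewrite !outsideE // !insideE // sE tE.
Qed.

End LocalChange.

(** * The first Reidemeister move *)

Section Moves.
Variables (R : realType) (n : nat).
Implicit Types (D E : diagram R n) (i : 'I_n).

Lemma weight_same_strand k (S : 'I_k -> strand R n) E i s t a x :
  ~ on_strands S (i, s) -> ~ on_strands S (i, t) ->
  on_strand (S a) (i, x.1) -> on_strand (S a) (i, x.2) -> weight E i s t x = 0.
Proof.
move=> offs offt on1 on2; rewrite /weight.
have [e1 _] := same_strand_inside offs offt on1 on2.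
have [_ e2] := same_strand_inside offs offt on2 on2.
by rewrite e1 e2 andbN.
Qed.

Lemma crossing_term_index0 E i c : intersection_index E i c.1 c.2 = 0 ->
  crossing_term E i c = 0.
Proof. by move=> e; rewrite /crossing_term e expr0 subrr mul0rz. Qed.

(** The loop of the curl lies in the disc, where the strand has no other double
    point. *)
Lemma reidemeister1_p_sc D D' : generic_diagram D -> generic_diagram D' ->
  reidemeister1 D D' -> p_sc D = p_sc D'.
Proof.
move=> gD gD' [phi [T [sigma [sigma' [change _ [s [t [/andP[ls st] [th one]]]]
  none]]]]].
pose S (_ : 'I_1) := T.
have on1 E i x : E = D \/ E = D' -> double_point E (i, x.1) (i, x.2) ->
    on_strands S (i, x.1) -> on_strand T (i, x.1) /\ on_strand T (i, x.2).
  move=> ED dx onx; have [b hb] := (on_strandsC change ED dx).1 onx.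
  by case: onx => a ha; split; [exact: ha|exact: hb].
have [[[_ inj _ _] _] _ _ arcs _] := change.
have same E sg i x : E = D /\ sg = sigma \/ E = D' /\ sg = sigma' ->
    double_point E (i, x.1) (i, x.2) -> on_strands S (i, x.1) ->
    [/\ x.1 <> x.2, sg x.1 = sg x.2,
        strand_lo T <= x.1 <= strand_hi T & strand_lo T <= x.2 <= strand_hi T].
  move=> ED dx onx; have ED' : E = D \/ E = D' by case: ED => -[-> _]; [left|right].
  have [[/= ci i1] [/= _ i2]] := on1 _ _ _ ED' dx onx.
  have [_ _ nx] := dx; rewrite /pos /= ci => ex.
  have [a1 b1 c1 d1] := arcs ord0 _ i1; have [a2 b2 c2 d2] := arcs ord0 _ i2.
  split=> //; first by move=> e; apply: nx; rewrite e.
  by case: ED ex => -[-> ->]; rewrite ?c1 ?c2 ?d1 ?d2 => /inj; rewrite !inE; apply.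
have curl i x : double_point D (i, x.1) (i, x.2) -> on_strands S (i, x.1) ->
    x = (s, t) \/ x = (t, s).
  move=> dx onx; have [ne e /andP[l1 h1] /andP[l2 h2]] :=
    same D sigma i x (or_introl (conj erefl erefl)) dx onx.
  rewrite [x]surjective_pairing; case: (ltgtP x.1 x.2) => [lt|gt|//].
    left; have hx : strand_lo T <= x.1 < x.2 by rewrite l1.
    by have [-> ->] := (one _ _ hx h2).1 e.
  right; have hx : strand_lo T <= x.2 < x.1 by rewrite l2.
  by have [-> ->] := (one _ _ hx h1).1 (esym e).
apply: (local_p_sc gD gD' change) => [i u v offu offv|i].
  transitivity (0 : int); last apply/esym; apply: fsum_eq0 => x [[dx _] onx].
    have [m1 m2] := on1 _ _ _ (or_introl erefl) dx onx.
    exact: (@weight_same_strand _ S D i u v ord0).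
  have [m1 m2] := on1 _ _ _ (or_intror erefl) dx onx.
  exact: (@weight_same_strand _ S D' i u v ord0).
transitivity (0 : mpoly n int); last apply/esym; apply: fsum_eq0 => c [[dc _] onc];
  last first.
  have [ne e /andP[l1 h1] /andP[l2 h2]] :=
    same D' sigma' i c (or_intror (conj erefl erefl)) dc onc.
  case: (ltgtP c.1 c.2) => [lt|gt|//].
    by case: (none c.1 c.2) => //; rewrite l1.
  by case: (none c.2 c.1) => //; rewrite l2.
apply: crossing_term_index0; apply: etrans (intersection_indexE _ _ _ _) _.
apply: fsum_eq0 => x [dx _].
have [m1 m2] := on1 _ _ _ (or_introl erefl) dc onc.
case ins : (inside c.1 c.2 x.1); last by rewrite /weight ins.
have onx : on_strands S (i, x.1).
  exists ord0; move: m1 m2 => [/= ci /andP[? ?]] [_ /andP[/= ? ?]]; split=> //=.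
  by clear ci; move: ins; rewrite /inside gt_min lt_max; lra.
apply: weight_endpoints.
by case: (curl i c dc onc) => ->; case: (curl i x dx onx) => ->; rewrite /=; auto.
Qed.

End Moves.

(** * Systems of graphs in a disc *)

(** The common setting of the second and third moves: both sides of such a move are
    systems of graphs over the same strands, with different functions G. *)
Record arc_system (R : realType) (n k : nat) (phi : R * R -> R * R)
    (S : 'I_k -> strand R n) (e : 'I_k -> bool) (G : 'I_k -> R -> R)
    (E : diagram R n) : Prop := ArcSystem {
  arc_generic : generic_diagram E;
  arc_chart : disc_chart phi;
  arc_strand_ok : forall a, strand_ok (S a);
  arc_disjoint : forall a b p,
    on_strand (S a) p -> on_strand (S b) p -> a = b;
  arc_curve : forall a t, strand_lo (S a) <= t <= strand_hi (S a) ->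
    model_box (graph_arc (S a) (e a) (G a) t) /\
    curve E (strand_comp (S a)) t = phi (graph_arc (S a) (e a) (G a) t);
  arc_in_box : forall p, in_domain E p ->
    (phi @` @model_box R) (pos E p) -> on_strands S p;
  arc_derivable : forall a x, derivable (G a) x 1 }.

Lemma local_change_arc_system (R : realType) (n k : nat) (phi : R * R -> R * R)
    (S : 'I_k -> strand R n) (e : 'I_k -> bool) (G G' : 'I_k -> R -> R)
    (D D' : diagram R n) :
  generic_diagram D -> generic_diagram D' ->
  (forall a x, derivable (G a) x 1) -> (forall a x, derivable (G' a) x 1) ->
  local_change phi S (fun a => graph_arc (S a) (e a) (G a))
    (fun a => graph_arc (S a) (e a) (G' a)) D D' ->
  arc_system phi S e G D /\ arc_system phi S e G' D'.
Proof.
move=> gD gD' dG dG' [[chart _] [ok disj] box arcs _].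
split; split=> //.
- by move=> a t tS; have [b b' c c'] := arcs a t tS.
- by move=> p dp bp; apply: (box D p) => //; left.
- by move=> a t tS; have [b b' c c'] := arcs a t tS.
- by move=> p dp bp; apply: (box D' p) => //; right.
Qed.

Section GraphArcs.
Variables (R : realType) (n k : nat) (phi : R * R -> R * R).
Variables (S : 'I_k -> strand R n) (e : 'I_k -> bool) (G : 'I_k -> R -> R).
Variable E : diagram R n.
Hypothesis sys : arc_system phi S e G E.

Let gE := arc_generic sys.
Let chart := arc_chart sys.
Let S_ok := arc_strand_ok sys.
Let S_disjoint := arc_disjoint sys.
Let arcs := arc_curve sys.
Let in_box := arc_in_box sys.
Let dG := arc_derivable sys.

(** The inverse of the abscissa, which is affine on each strand. *)
Definition arc_param a (x : R) : R :=
  strand_lo (S a) +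
  (strand_hi (S a) - strand_lo (S a)) * ((if e a then x else - x) + 1) / 2%:R.

Definition arc_abscissa a (t : R) : R :=
  let x0 := 2%:R * (t - strand_lo (S a)) / (strand_hi (S a) - strand_lo (S a)) - 1
  in if e a then x0 else - x0.

Definition arc_point a (x : R) : param R n := (strand_comp (S a), arc_param a x).

Definition direction a : int := if e a then 1 else -1.

Let graph_arcE a t :
  graph_arc (S a) (e a) (G a) t = (arc_abscissa a t, G a (arc_abscissa a t)).
Proof. by []. Qed.

Lemma arc_paramK a : cancel (arc_param a) (arc_abscissa a).
Proof.
have [_ lh _] := S_ok a; move=> x; rewrite /arc_abscissa /arc_param.
by case: (e a); field; lra.
Qed.

Lemma arc_abscissaK a : cancel (arc_abscissa a) (arc_param a).
Proof.
have [_ lh _] := S_ok a; move=> x; rewrite /arc_abscissa /arc_param.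
by case: (e a); field; lra.
Qed.

Lemma arc_param_lt a x y :
  (arc_param a x < arc_param a y) = if e a then x < y else y < x.
Proof.
have [_ lh _] := S_ok a; rewrite /arc_param ltrD2l ltr_pM2r ?invr_gt0 ?ltr0n //.
by rewrite ltr_pM2l ?subr_gt0 // ltrD2r; case: (e a) => //; rewrite ltrN2.
Qed.

Lemma arc_param_lohi a : arc_param a (if e a then -1 else 1) = strand_lo (S a) /\
  arc_param a (if e a then 1 else -1) = strand_hi (S a).
Proof. by rewrite /arc_param; case: (e a); split; field. Qed.

Lemma arc_param_in a x : -1 <= x <= 1 ->
  strand_lo (S a) <= arc_param a x <= strand_hi (S a).
Proof.
move=> /andP[x1 x2]; have [lo hi] := arc_param_lohi a.
rewrite -[leLHS]lo -[X in _ && (_ <= X)]hi !leNgt !arc_param_lt.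
by case: (e a); rewrite -!leNgt x1 x2.
Qed.

Lemma arc_param_lt_hi a x : -1 < x < 1 -> arc_param a x < strand_hi (S a).
Proof.
move=> /andP[x1 x2]; have [lo hi] := arc_param_lohi a.
by rewrite -hi arc_param_lt; case: (e a).
Qed.

Lemma arc_abscissa_in a t : strand_lo (S a) <= t <= strand_hi (S a) ->
  -1 <= arc_abscissa a t <= 1.
Proof.
have [lo hi] := arc_param_lohi a.
move: (arc_abscissaK a t); set y := arc_abscissa a t => <-.
rewrite -{1}lo -{1}hi !leNgt !arc_param_lt.
by case: (e a); rewrite -!leNgt //; rewrite andbC.
Qed.

Lemma arc_point_on a x : -1 <= x <= 1 -> on_strand (S a) (arc_point a x).
Proof. by move=> x1; split=> //; exact: arc_param_in. Qed.

Lemma strand_in_domain p : on_strands S p -> in_domain E p.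
Proof.
case: p => i t [a [/= _ /andP[lt th]]]; have [l0 _ h1] := S_ok a.
by apply: in_domain_ge0_lt1; apply/andP; split; lra.
Qed.

Let pos_arc a x : -1 <= x <= 1 -> pos E (arc_point a x) = phi (x, G a x).
Proof.
move=> x1; have [_ c] := arcs (arc_param_in a x1).
by rewrite /pos /= c graph_arcE arc_paramK.
Qed.

Let box_arc a x : -1 <= x <= 1 -> model_box (x, G a x).
Proof.
by move=> x1; have [+ _] := arcs (arc_param_in a x1); rewrite graph_arcE arc_paramK.
Qed.

Lemma double_arc a b x : a <> b -> -1 <= x <= 1 -> G a x = G b x ->
  double_point E (arc_point a x) (arc_point b x).
Proof.
move=> nab x1 ab; split.
- by apply: strand_in_domain; exists a; exact: arc_point_on.
- by apply: strand_in_domain; exists b; exact: arc_point_on.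
- move=> eab; apply: nab; apply: S_disjoint (arc_point_on a x1) _.
  by rewrite eab; exact: arc_point_on.
- by rewrite !pos_arc // ab.
Qed.

Lemma double_arc_inv p q : double_point E p q -> on_strands S p ->
  exists a b x, [/\ a <> b, -1 <= x <= 1, G a x = G b x,
    p = arc_point a x & q = arc_point b x].
Proof.
move=> [dp dq npq epos] onp.
have point a r : on_strand (S a) r -> exists2 x, -1 <= x <= 1 & r = arc_point a x.
  case: r => i t [/= -> ta]; exists (arc_abscissa a t); first exact: arc_abscissa_in.
  by rewrite /arc_point arc_abscissaK.
case: onp => a /point [x x1 pE].
have [b /point [y y1 qE]] : on_strands S q.
  by apply: in_box => //; rewrite -epos pE pos_arc //; exists (x, G a x) => //;
    exact: box_arc.
move: epos; rewrite pE qE !pos_arc //.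
have [_ inj _ _] := chart.
move=> /inj; rewrite !inE => /(_ (box_arc a x1) (box_arc b y1)) -[xy Gxy].
rewrite -xy in qE Gxy *; exists a, b, x; split=> // ab.
by apply: npq; rewrite pE qE ab.
Qed.

Let direction_sgz a : sgz
  ((if e a then 2%:R else - 2%:R) / (strand_hi (S a) - strand_lo (S a)))
  = direction a.
Proof.
have [_ lh _] := S_ok a.
have p : 0 < 2%:R / (strand_hi (S a) - strand_lo (S a)).
  by rewrite divr_gt0 ?subr_gt0 ?ltr0n.
by rewrite /direction; case: (e a); rewrite ?mulNr ?sgzN gtr0_sgz.
Qed.

Lemma velocity_arc a x : -1 < x < 1 -> velocity E (arc_point a x) =
  'd phi (x, G a x)
    (((if e a then 2%:R else - 2%:R) / (strand_hi (S a) - strand_lo (S a)))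
       *: (1, ((G a)^`() x)%classic)).
Proof.
move=> x1; set t := arc_param a x.
have xle : -1 <= x <= 1 by case/andP: x1 => /ltW -> /ltW ->.
have /andP[lt th] := arc_param_in a xle; have th' := arc_param_lt_hi a x1.
have [[dphi _] _ _ _] := chart.
set c := _ / _; pose h (y : R) := (y, G a y).
have dh y : derivable h y 1.
  by apply/derivable1_diffP; apply: differentiable_pair => //; exact/derivable1_diffP.
have h' y : (h^`() y)%classic = (1, ((G a)^`() y)%classic).
  have dGy : differentiable (G a) y by exact/derivable1_diffP.
  rewrite derive1E'; last exact/derivable1_diffP.
  have did : derivable (@id R) y 1 by exact: derivable_id.
  have fid : differentiable (@id R) y by exact/derivable1_diffP.
  by rewrite (diff_pair fid dGy) /= -derive1E' // derive1E derive_id -derive1E'.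
pose b := arc_abscissa a 0.
have absE u : arc_abscissa a u = c *: u + b.
  rewrite /b /arc_abscissa /c /GRing.scale /=; have [_ lh _] := S_ok a.
  by case: (e a); field; lra.
have [dX X'] : derivable (arc_abscissa a) t 1 /\ ((arc_abscissa a)^`() t)%classic = c.
  have -> : arc_abscissa a = (fun u => c *: u + b) by apply/funext.
  have did : derivable (@id R) t 1 by exact: derivable_id.
  have dcu : derivable (fun u : R => c *: u) t 1 by exact: derivableZ.
  have [d1 ->] := @derive1_addr R _ (fun u : R => c *: u) b t dcu.
  split=> //; rewrite derive1E; apply: etrans (deriveZ _ did) _.
  by rewrite derive_id /GRing.scale /= mulr1.
have tx : arc_abscissa a t = x by exact: arc_paramK.
have dc : derivable (h \o arc_abscissa a) t 1.
  apply/derivable1_diffP/differentiable_comp; first exact/derivable1_diffP.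
  exact/derivable1_diffP.
have E1 := derive1_diff_comp dc (dphi _).
have E2 := derive1_scalar_comp (dh (arc_abscissa a t)) dX.
rewrite E2 /= tx h' X' in E1.
rewrite /h in E1; rewrite -E1.
apply: (@derive1_right_eq _ _ _ _ _ (strand_hi (S a) - t)).
- exact: derivable_curve.
- exact: derivable_diff_comp.
- by rewrite subr_gt0.
- move=> u /andP[tu ut]; have [|_ ->] := @arcs a u; last by [].
  by rewrite (le_trans lt tu) ltW //; move: ut; rewrite subrKC.
Qed.

(** In the chart, strand a has a velocity proportional to (1, (G a)^`() x), with a
    factor of sign [direction a], and the Jacobian of the chart has a constant
    sign. *)
Lemma sgn_arc a b x : a <> b -> -1 < x < 1 -> G a x = G b x ->
  sgn E (arc_point a x) (arc_point b x) =
  sgz (Defs.jacobian phi (0, 0)) * (direction a * direction b)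
  * sgz (((G b)^`() x)%classic - ((G a)^`() x)%classic).
Proof.
move=> nab x1 ab; have xle : -1 <= x <= 1 by case/andP: x1 => /ltW -> /ltW ->.
have [[dphi cphi] _ nz _] := chart.
rewrite /sgn !velocity_arc // -ab wedge_diff // wedgeZ /wedge /= mul1r mulr1.
have J : sgz (Defs.jacobian phi (x, G a x)) = sgz (Defs.jacobian phi (0, 0)).
  apply: sgz_jacobian_segment => // u u01; apply: nz.
  have [/andP[b1 b2] /andP[b3 b4]] := box_arc a xle.
  move: b1 b2 b3 b4 u01; rewrite /= => b1 b2 b3 b4 /andP[u0 u1].
  rewrite /model_box /= !sub0r /GRing.scale /=.
  by split; apply/andP; split; nra.
exact: sgz_mul4 J (direction_sgz a) (direction_sgz b).
Qed.

Lemma transverse_arc a b x : a <> b -> -1 < x < 1 -> G a x = G b x ->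
  ((G b)^`() x)%classic - ((G a)^`() x)%classic <> 0.
Proof.
move=> nab x1 ab z; have xle : -1 <= x <= 1 by case/andP: x1 => /ltW -> /ltW ->.
have := generic_transverse gE (double_arc nab xle ab).
move=> /eqP; rewrite -sgz_eq0 => /eqP; apply.
by apply: etrans (sgn_arc nab x1 ab) _; rewrite z sgz0 mulr0.
Qed.

Lemma strand_lt a b u v : a <> b -> strand_comp (S a) = strand_comp (S b) ->
  strand_lo (S a) <= u <= strand_hi (S a) ->
  strand_lo (S b) <= v <= strand_hi (S b) ->
  (u < v) = (strand_lo (S a) < strand_lo (S b)).
Proof.
move=> nab cab ua vb.
have [_ la _] := S_ok a; have [_ lb _] := S_ok b.
have nb : ~ strand_lo (S a) <= strand_lo (S b) <= strand_hi (S a).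
  move=> h; apply: nab; apply: (@S_disjoint a b (strand_comp (S b), strand_lo (S b))).
    by split; [exact/esym|exact: h].
  by split; rewrite //= lexx ltW.
have na : ~ strand_lo (S b) <= strand_lo (S a) <= strand_hi (S b).
  move=> h; apply: nab; apply: (@S_disjoint a b (strand_comp (S a), strand_lo (S a))).
    by split; rewrite //= lexx ltW.
  by split; [exact: cab|exact: h].
move/negP: nb; move/negP: na; clear cab nab.
case: (ltP (strand_lo (S a)) (strand_lo (S b))) => ab; rewrite !negb_and; lra.
Qed.

Section Crossings.
Variables (L : seq ('I_k * 'I_k * R)) (M : 'I_k -> 'I_k -> crossing_mark).
Hypothesis L_uniq : uniq L.
Hypothesis L_spec : forall a b x, (a, b, x) \in L <->
  [/\ a <> b, -1 <= x <= 1 & G a x = G b x].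
Hypothesis M_spec : forall a b x, (a, b, x) \in L ->
  mark E (arc_point a x) (arc_point b x) = M a b.

Definition crossing_pair (l : 'I_k * 'I_k * R) : R * R :=
  (arc_param l.1.1 l.2, arc_param l.1.2 l.2).

(** The crossings in the disc are labelled by the two strands and the abscissa; q
    selects them by their marks, so that the lemma serves for flat crossings and
    for the upper-lower pairs of self-crossings. *)
Lemma crossing_sum (V : nmodType) (q : crossing_mark -> bool) i (F : R * R -> V) :
  \sum_(x \in [set x | double_pairs E i x /\ q (mark E (i, x.1) (i, x.2))]
              `&` strand_pairs S i) F x =
  \sum_(l <- L | [&& strand_comp (S l.1.1) == i, strand_comp (S l.1.2) == i
                   & q (M l.1.1 l.1.2)]) F (crossing_pair l).
Proof.
pose ok (l : 'I_k * 'I_k * R) := [&& strand_comp (S l.1.1) == i,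
  strand_comp (S l.1.2) == i & q (M l.1.1 l.1.2)].
have -> : \sum_(l <- L | ok l) F (crossing_pair l) =
    \sum_(x <- [seq crossing_pair l | l <- [seq l <- L | ok l]]) F x.
  by rewrite big_map big_filter.
apply: fsum_seq.
  rewrite map_inj_in_uniq ?filter_uniq // => -[[a b] x] [[a' b'] x'].
  rewrite !mem_filter /= => /andP[/and3P[/eqP ia /eqP ib _] /L_spec[_ x1 _]].
  move=> /andP[/and3P[/eqP ia' /eqP ib' _] /L_spec[_ x1' _]] [ea eb].
  have aa : a = a'.
    apply: S_disjoint (arc_point_on a x1) _.
    by have := arc_point_on a' x1'; rewrite /arc_point -ea ia ia'.
  have bb : b = b'.
    apply: S_disjoint (arc_point_on b x1) _.
    by have := arc_point_on b' x1'; rewrite /arc_point -eb ib ib'.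
  by move: ea; rewrite -aa -bb => /(can_inj (@arc_paramK a)) ->.
apply/seteqP; split=> [[u v] [[duv quv] onu]|c] /=.
  have [a [b [x [nab x1 ab [ia ua] [ib vb]]]]] := double_arc_inv duv onu.
  have Lx : (a, b, x) \in L by apply/L_spec.
  apply/mapP; exists (a, b, x); last by rewrite /crossing_pair /= -ua -vb.
  rewrite mem_filter Lx andbT /ok /= -ia -ib !eqxx /=.
  by rewrite -(M_spec Lx) /arc_point -ia -ib -ua -vb.
move=> /mapP[[[a b] x]];
  rewrite mem_filter /= => /andP[/and3P[/eqP ia /eqP ib qM] Lx] ->.
have [nab x1 ab] := (L_spec a b x).1 Lx.
have dab := double_arc nab x1 ab.
have onp := arc_point_on a x1; rewrite /arc_point ia ib in dab onp.
split; last by exists a.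
by split=> //=; rewrite -{1}ia -{1}ib -/(arc_point _ _) (M_spec Lx).
Qed.

End Crossings.

End GraphArcs.

Section Weights.
Variables (R : realType) (n : nat).
Implicit Types (E : diagram R n) (i : 'I_n).

(** A flat crossing occurs as two ordered pairs of parameters, of which at most one
    goes from the inside to the outside. *)
Lemma weight_pair E i s t u v : u != s -> u != t -> v != s -> v != t ->
  weight E i s t (u, v) + weight E i s t (v, u) =
  sgn E (i, u) (i, v) * ((inside s t u)%:R - (inside s t v)%:R).
Proof.
move=> us ut vs vt; rewrite /weight /= !outsideE //.
rewrite (sgn_swap E (i, u) (i, v)); move: (sgn E _ _) => g.
by case: (inside s t u); case: (inside s t v);
  rewrite /= ?subrr ?addr0 ?add0r ?subr0 ?sub0r ?mulr0 ?mulr1 ?mulrN1.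
Qed.

Lemma eq_crossing_termN E E' i c c' :
  absz (intersection_index E i c.1 c.2) = absz (intersection_index E' i c'.1 c'.2) ->
  sgn E (i, c.1) (i, c.2) = - sgn E' (i, c'.1) (i, c'.2) ->
  crossing_term E i c = - crossing_term E' i c'.
Proof.
move=> e1 e2.
apply: etrans (congr2 (fun a b => (tvar i ^+ a - 1) *~ b) e1 e2) _.
exact: mulrNz.
Qed.

Definition nonvirtual (m : crossing_mark) : bool :=
  if m is Virtual then false else true.

Definition is_over (m : crossing_mark) : bool := if m is Over then true else false.

Lemma flat_pairsE E i : flat_pairs E i =
  [set x | double_pairs E i x /\ nonvirtual (mark E (i, x.1) (i, x.2))].
Proof.
by apply/seteqP; split=> x [dx] m; split=> //; move: m; case: (mark _ _ _).
Qed.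

Lemma self_crossingsE E i : self_crossings E i =
  [set x | double_pairs E i x /\ is_over (mark E (i, x.1) (i, x.2))].
Proof.
by apply/seteqP; split=> x [dx] m; split=> //; move: m; case: (mark _ _ _).
Qed.

End Weights.

(** * The second Reidemeister move *)

Section Reidemeister2.
Variables (R : realType) (n : nat) (phi : R * R -> R * R).
Variables (S : 'I_2 -> strand R n) (e : 'I_2 -> bool) (g h : 'I_2 -> R -> R).
Variables (m : crossing_mark) (D D' : diagram R n) (x1 x2 : R).
Let i0 : 'I_2 := ord0.
Let i1 : 'I_2 := ord_max.
Hypothesis change : local_change phi S (fun a => graph_arc (S a) (e a) (g a))
  (fun a => graph_arc (S a) (e a) (h a)) D D'.
Hypotheses (sys : arc_system phi S e g D) (sys' : arc_system phi S e h D').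
Hypotheses (x1_gt : -1 < x1) (x12 : x1 < x2) (x2_lt : x2 < 1).
Hypothesis g_meet : forall x, -1 <= x <= 1 -> g i0 x = g i1 x <-> x = x1 \/ x = x2.
Hypothesis h_disjoint : forall x, -1 <= x <= 1 -> h i0 x <> h i1 x.
Hypothesis g_mark : marked D (S i0) (S i1) m.

Let gD := arc_generic sys.
Let gD' := arc_generic sys'.

Let L : seq ('I_2 * 'I_2 * R) :=
  [:: (i0, i1, x1); (i0, i1, x2); (i1, i0, x1); (i1, i0, x2)].

Let M (a b : 'I_2) : crossing_mark := if a == i0 then m else flip_mark m.

Let ord2P (a : 'I_2) : a = i0 \/ a = i1.
Proof. by case: a => -[|[|//]] p; [left|right]; apply/val_inj. Qed.

Let n01 : i0 <> i1. Proof. by []. Qed.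

Let x1_in : -1 < x1 < 1. Proof. by rewrite x1_gt (lt_trans x12). Qed.
Let x2_in : -1 < x2 < 1. Proof. by rewrite x2_lt (lt_trans x1_gt). Qed.
Let x1_le : -1 <= x1 <= 1. Proof. by case/andP: x1_in => /ltW -> /ltW ->. Qed.
Let x2_le : -1 <= x2 <= 1. Proof. by case/andP: x2_in => /ltW -> /ltW ->. Qed.
Let g1 : g i0 x1 = g i1 x1. Proof. by apply/g_meet; [|left]. Qed.
Let g2 : g i0 x2 = g i1 x2. Proof. by apply/g_meet; [|right]. Qed.

Let L_uniq : uniq L.
Proof.
by rewrite /L /= !inE !xpair_eqE !eqxx /= (lt_eqF x12).
Qed.

Let L_spec a b x : (a, b, x) \in L <-> [/\ a <> b, -1 <= x <= 1 & g a x = g b x].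
Proof.
rewrite /L !inE !xpair_eqE; split.
  by case/or4P => /andP[/andP[/eqP -> /eqP ->] /eqP ->]; split.
move=> [ab x_in]; have [ea|ea] := ord2P a; have [eb|eb] := ord2P b; subst a b => //.
  by move/(g_meet x_in) => [->|->]; rewrite !eqxx ?orbT.
by move=> /esym/(g_meet x_in) => -[->|->]; rewrite !eqxx ?orbT.
Qed.

Let M_spec a b x : (a, b, x) \in L ->
  mark D (arc_point S e a x) (arc_point S e b x) = M a b.
Proof.
move=> /L_spec [ab x_in]; have [ea|ea] := ord2P a; have [eb|eb] := ord2P b;
  subst a b => // gx.
  apply: g_mark; [exact: (arc_point_on sys)|exact: (arc_point_on sys)|].
  exact: (double_arc sys).
have d01 := double_arc sys n01 x_in (esym gx).
rewrite (generic_mark gD d01) /M /=; congr flip_mark.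
by apply: g_mark; [exact: (arc_point_on sys)|exact: (arc_point_on sys)|].
Qed.

Let sgn_opposite : sgn D (arc_point S e i0 x1) (arc_point S e i1 x1) =
  - sgn D (arc_point S e i0 x2) (arc_point S e i1 x2).
Proof.
rewrite (sgn_arc sys n01 x1_in g1) (sgn_arc sys n01 x2_in g2) -mulrN.
apply: (congr1 ( *%R _)).
have dg := arc_derivable sys.
have dB x : ((fun u => g i1 u - g i0 u)^`() x)%classic =
    ((g i1)^`() x)%classic - ((g i0)^`() x)%classic.
  by rewrite !derive1E; exact: deriveB.
rewrite -!dB; apply: slope_alternate => //.
- by move=> x; exact: derivableB.
- by rewrite g1 subrr.
- by rewrite g2 subrr.
- move=> x xi /subr0_eq /esym /g_meet [].
    case/andP: xi => xi1 xi2; rewrite (ltW (lt_trans x1_gt xi1)).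
    exact: ltW (lt_trans xi2 x2_lt).
    by move=> xE; move: xi; rewrite xE ltxx.
  by move=> xE; move: xi; rewrite xE ltxx andbF.
- by rewrite dB; exact: (transverse_arc sys).
- by rewrite dB; exact: (transverse_arc sys).
Qed.

Let sum_L (V : zmodType) (P : pred ('I_2 * 'I_2 * R)) (F : _ -> V) :
  \sum_(l <- L | P l) F l =
  (if P (i0, i1, x1) then F (i0, i1, x1) else 0)
  + ((if P (i0, i1, x2) then F (i0, i1, x2) else 0)
  + ((if P (i1, i0, x1) then F (i1, i0, x1) else 0)
  + (if P (i1, i0, x2) then F (i1, i0, x2) else 0))).
Proof. by rewrite big_mkcond /L !big_cons big_nil /= addr0. Qed.

Let empty_sum (V : nmodType) (q : crossing_mark -> bool) i (F : R * R -> V) :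
  \sum_(x \in [set x | double_pairs D' i x /\ q (mark D' (i, x.1) (i, x.2))]
              `&` strand_pairs S i) F x = 0.
Proof.
apply: fsum_eq0 => x [[dx _] onx].
have [a [b [y [ab y_in]]]] := double_arc_inv sys' dx onx.
have [ea|ea] := ord2P a; have [eb|eb] := ord2P b; subst a b => // hy.
  by case: (h_disjoint y_in hy).
by case: (h_disjoint y_in (esym hy)).
Qed.

(** The smoothings at the two crossings differ only by the arcs between these
    crossings, which meet nothing else.  Each of the two crossings contributes to
    the index of the other one, by equal amounts. *)
Let index_same i : strand_comp (S i0) = i -> strand_comp (S i1) = i ->
  nonvirtual m ->
  intersection_index D i (arc_param S e i0 x1) (arc_param S e i1 x1) =
  intersection_index D i (arc_param S e i0 x2) (arc_param S e i1 x2).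
Proof.
move=> c0 c1 nv.
have [p1 p2] := (arc_point_on sys i0 x1_le, arc_point_on sys i0 x2_le).
have [q1 q2] := (arc_point_on sys i1 x1_le, arc_point_on sys i1 x2_le).
rewrite /arc_point c0 in p1 p2; rewrite /arc_point c1 in q1 q2.
apply: etrans (index_split S _ _ _ gD) _.
apply/esym; apply: etrans (index_split S _ _ _ gD) _; apply/esym.
apply: (congr2 (fun a b => a + b)); last first.
  apply: (outer_weights_self change) => u off.
  exact: (same_strand_outer p1 p2 q1 q2 off).
have nv' : nonvirtual (flip_mark m) by move: nv; case: (m).
have inner s t : \sum_(x \in flat_pairs D i `&` strand_pairs S i) weight D i s t x =
    weight D i s t (arc_param S e i0 x1, arc_param S e i1 x1)
    + (weight D i s t (arc_param S e i0 x2, arc_param S e i1 x2)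
    + (weight D i s t (arc_param S e i1 x1, arc_param S e i0 x1)
    + weight D i s t (arc_param S e i1 x2, arc_param S e i0 x2))).
  rewrite flat_pairsE.
  apply: etrans (crossing_sum sys L_uniq L_spec M_spec nonvirtual i (weight D i s
    t)) _.
  by apply: etrans (sum_L _ _) _; rewrite /= c0 c1 eqxx /M /= nv nv'.
apply: etrans (inner _ _) _; apply/esym; apply: etrans (inner _ _) _; apply/esym.
have u12 := arc_param_lt sys i0 x1 x2; have u21 := arc_param_lt sys i0 x2 x1.
have v12 := arc_param_lt sys i1 x1 x2; have v21 := arc_param_lt sys i1 x2 x1.
have c01 : strand_comp (S i0) = strand_comp (S i1) by rewrite c0 c1.
have vu y z : -1 <= y <= 1 -> -1 <= z <= 1 ->
    (arc_param S e i1 z < arc_param S e i0 y) = (strand_lo (S i1) < strand_lo (S i0)).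
  by move=> yi zi; apply: (strand_lt sys (nesym n01) (esym c01));
    exact: (arc_param_in sys).
have uv y z : -1 <= y <= 1 -> -1 <= z <= 1 ->
    arc_param S e i0 y != arc_param S e i1 z.
  move=> yi zi; apply/eqP => E; apply: n01.
  apply: (arc_disjoint sys (arc_point_on sys i0 yi)).
  have := arc_point_on sys i1 zi; by rewrite /arc_point c1 c0 E.
have uv_lt y z : -1 <= y <= 1 -> -1 <= z <= 1 ->
    (arc_param S e i0 y < arc_param S e i1 z) =
      ~~ (strand_lo (S i1) < strand_lo (S i0)).
  by move=> yi zi; rewrite -(vu y z) // -leNgt le_eqVlt (negPf (uv y z yi zi)).
have nx12 : (x1 == x2) = false by exact: lt_eqF.
have nu : arc_param S e i0 x1 != arc_param S e i0 x2.
  by rewrite (can_eq (arc_paramK sys i0)) nx12.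
have nv12 : arc_param S e i1 x1 != arc_param S e i1 x2.
  by rewrite (can_eq (arc_paramK sys i1)) nx12.
have vu12 := vu _ _ x2_le x1_le; have vu21 := vu _ _ x1_le x2_le.
have uv12 := uv_lt _ _ x1_le x2_le; have uv21 := uv_lt _ _ x2_le x1_le.
have n12 := uv _ _ x1_le x2_le; have n21 := uv _ _ x2_le x1_le.
have so := sgn_opposite; rewrite /arc_point c0 c1 in so.
move: u12 u21 v12 v21 nu nv12 vu12 vu21 uv12 uv21 n12 n21 so {inner uv uv_lt vu p1
  p2 q1 q2}.
rewrite x12 (lt_gtF x12) /=.
move: (arc_param S e i0 x1) (arc_param S e i0 x2) (arc_param S e i1 x1)
  (arc_param S e i1 x2).
move=> u1 u2 v1 v2 u12 u21 v12 v21 nu nv12 vu12 vu21 uv12 uv21 n12 n21 so.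
have sumA (a b c d : int) : a = 0 -> c = 0 -> a + (b + (c + d)) = b + d.
  by move=> -> ->; rewrite !add0r.
have sumB (a b c d : int) : b = 0 -> d = 0 -> a + (b + (c + d)) = a + c.
  by move=> -> ->; rewrite addr0 add0r.
apply: etrans (sumA _ _ _ _ _ _) _.
- by apply: weight_endpoints; left.
- by apply: weight_endpoints; right.
apply/esym; apply: etrans (sumB _ _ _ _ _ _) _.
- by apply: weight_endpoints; left.
- by apply: weight_endpoints; right.
apply/esym.
have nu' : u2 != u1 by rewrite eq_sym.
have nv12' : v2 != v1 by rewrite eq_sym.
have n12' : v2 != u1 by rewrite eq_sym.
have n21' : v1 != u2 by rewrite eq_sym.
apply: etrans (weight_pair D i nu' n21 n12' nv12') _; apply/esym.
apply: etrans (weight_pair D i nu n12 n21' nv12) _; apply/esym.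
have iu2 := insideE nu' n21; have iv2 := insideE n12' nv12'.
have iu1 := insideE nu n12; have iv1 := insideE n21' nv12.
rewrite u12 vu12 in iu2; rewrite uv12 v12 in iv2.
rewrite u21 vu21 in iu1; rewrite uv21 v21 in iv1.
rewrite so iu1 iv1 iu2 iv2.
move: (sgn D _ _) (strand_lo _ < _) => z l.
by case: (e i0); case: (e i1); case: l => /=; ring.
Qed.

Lemma reidemeister2_arcs_p_sc : p_sc D = p_sc D'.
Proof.
apply: (local_p_sc gD gD' change) => [i s t offs offt|i].
  rewrite !flat_pairsE.
  apply: etrans (crossing_sum sys L_uniq L_spec M_spec nonvirtual i (weight D i s
    t)) _.
  apply/esym; apply: etrans (empty_sum _ _ _) _; apply/esym.
  apply: etrans (sum_L _ _) _ => /=.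
  case c0: (strand_comp (S i0) == i); last by rewrite /= !andbF !addr0.
  case c1: (strand_comp (S i1) == i); last by rewrite /= !addr0.
  move/eqP: c0 => c0; move/eqP: c1 => c1.
  have p1 := arc_point_on sys i0 x1_le; have p2 := arc_point_on sys i0 x2_le.
  have q1 := arc_point_on sys i1 x1_le; have q2 := arc_point_on sys i1 x2_le.
  rewrite /arc_point c0 in p1 p2; rewrite /arc_point c1 in q1 q2.
  have [pE _] := same_strand_inside offs offt p1 p2.
  have [qE _] := same_strand_inside offs offt q1 q2.
  have [_ pO1] := same_strand_inside offs offt p1 p1.
  have [_ pO2] := same_strand_inside offs offt p2 p2.
  have [_ qO1] := same_strand_inside offs offt q1 q1.
  have [_ qO2] := same_strand_inside offs offt q2 q2.
  have so := sgn_opposite; rewrite /arc_point c0 c1 in so.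
  rewrite /weight /crossing_pair /= pO1 pO2 qO1 qO2 pE qE.
  rewrite (sgn_swap D (i, arc_param S e i0 x1) (i, arc_param S e i1 x1)).
  rewrite (sgn_swap D (i, arc_param S e i0 x2) (i, arc_param S e i1 x2)) so.
  move: (sgn D _ _) (inside _ _ _) (inside _ _ _) (nonvirtual _) (nonvirtual _).
  by move=> z [] [] [] [] /=; rewrite ?addr0 ?add0r ?opprK ?oppr0 ?addNr ?subrr.
rewrite !self_crossingsE.
apply: etrans (crossing_sum sys L_uniq L_spec M_spec is_over i (crossing_term D i)) _.
apply/esym; apply: etrans (empty_sum _ _ _) _; apply/esym.
apply: etrans (sum_L _ _) _ => /=.
case c0: (strand_comp (S i0) == i); last by rewrite /= !andbF !addr0.
case c1: (strand_comp (S i1) == i); last by rewrite /= !addr0.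
move/eqP: c0 => c0; move/eqP: c1 => c1.
have so := sgn_opposite; rewrite /arc_point c0 c1 in so.
have E01 : nonvirtual m -> crossing_term D i (crossing_pair S e (i0, i1, x1)) =
    - crossing_term D i (crossing_pair S e (i0, i1, x2)).
  move=> nv; apply: eq_crossing_termN; last exact: so.
  by apply: (congr1 absz); exact: index_same.
have E10 : nonvirtual m -> crossing_term D i (crossing_pair S e (i1, i0, x1)) =
    - crossing_term D i (crossing_pair S e (i1, i0, x2)).
  move=> nv; apply: eq_crossing_termN; last first.
    apply: etrans (sgn_swap _ _ _) _; apply: etrans (congr1 -%R so) _.
    by apply: (congr1 -%R); apply/esym; exact: sgn_swap.
  apply: (congr1 absz); apply: etrans (intersection_indexC _ _ _ _) _.
  by apply/esym; apply: etrans (intersection_indexC _ _ _ _) _; apply/esym;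
    exact: index_same.
rewrite /M /=; case: (m) E01 E10 => //= E01 E10.
- by rewrite E01 // !addr0 addNr.
- by rewrite E10 // !add0r addNr.
- by rewrite !addr0.
- by rewrite !addr0.
Qed.

End Reidemeister2.

Lemma reidemeister2_p_sc (R : realType) (n : nat) (D D' : diagram R n) :
  generic_diagram D -> generic_diagram D' -> reidemeister2 D D' -> p_sc D = p_sc D'.
Proof.
move=> gD gD' [phi [S [e [g [h [m [change heights [x1 [x2 [/andP[x1a x12]
  [x2b gx]]]] hx [mS mk]]]]]]]].
have dg a x : derivable (g a) x 1 by have [[[]]] := heights a.
have dh a x : derivable (h a) x 1 by have [_ [[]]] := heights a.
have [sys sys'] := local_change_arc_system gD gD' dg dh change.
exact: (reidemeister2_arcs_p_sc change sys sys' x1a x12 x2b gx hx mk).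
Qed.

(** * The third Reidemeister move *)

Definition distinct3 (a b c : 'I_3) : Prop := [/\ a <> b, a <> c & b <> c].

Lemma ord3_cover a b c d : distinct3 a b c -> [\/ d = a, d = b | d = c].
Proof.
move=> [/eqP ab /eqP ac /eqP bc].
have : (d == a) || (d == b) || (d == c).
  by move: a b c d ab ac bc; do 4! case=> -[|[|[|//]]] //= ?.
by case/orP => [/orP[]|] /eqP; [constructor 1|constructor 2|constructor 3].
Qed.

Definition strand_pairs3 (a b c : 'I_3) : seq ('I_3 * 'I_3) :=
  [:: (a, b); (b, a); (a, c); (c, a); (b, c); (c, b)].

Lemma strand_pairs3_uniq a b c : distinct3 a b c -> uniq (strand_pairs3 a b c).
Proof.
move=> [/eqP ab /eqP ac /eqP bc]; rewrite /strand_pairs3 /= !inE !xpair_eqE.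
rewrite !eqxx (negPf ab) (negPf ac) (negPf bc) ![b == a]eq_sym ![c == _]eq_sym.
by rewrite (negPf ab) (negPf ac) (negPf bc).
Qed.

Lemma mem_strand_pairs3 a b c d f : distinct3 a b c ->
  ((d, f) \in strand_pairs3 a b c) = (d != f).
Proof.
move=> abc; have [/eqP ab /eqP ac /eqP bc] := abc; rewrite !inE !xpair_eqE.
have ba : b != a by rewrite eq_sym.
have ca : c != a by rewrite eq_sym.
have cb : c != b by rewrite eq_sym.
by case: (ord3_cover d abc) => ->; case: (ord3_cover f abc) => ->;
  rewrite ?eqxx ?(negPf ab) ?(negPf ac) ?(negPf bc) ?(negPf ba) ?(negPf ca)
    ?(negPf cb).
Qed.

Lemma eq_strand_pairs3 a b c (V : nmodType) (P : pred ('I_3 * 'I_3))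
    (F F' : 'I_3 * 'I_3 -> V) : distinct3 a b c ->
  (forall d f, d <> f -> P (d, f) -> F (d, f) = F' (d, f)) ->
  \sum_(p <- strand_pairs3 a b c | P p) F p =
  \sum_(p <- strand_pairs3 a b c | P p) F' p.
Proof.
move=> abc FF'; rewrite big_seq_cond [RHS]big_seq_cond.
apply: eq_bigr => -[d f]; rewrite mem_strand_pairs3 // => /andP[/eqP df].
exact: FF'.
Qed.

Lemma nonvirtual_flip m : nonvirtual (flip_mark m) = nonvirtual m.
Proof. by case: m. Qed.

Section Triangle.
Variables (R : realType) (n : nat) (phi : R * R -> R * R).
Variables (S : 'I_3 -> strand R n) (e : 'I_3 -> bool) (G : 'I_3 -> R -> R).
Variables (E : diagram R n) (M : 'I_3 -> 'I_3 -> crossing_mark).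
Variables (x : 'I_3 -> 'I_3 -> R) (slope : 'I_3 -> 'I_3 -> int).
Hypothesis sys : arc_system phi S e G E.
Hypothesis x_sym : forall a b, x a b = x b a.
Hypothesis x_in : forall a b, a <> b -> -1 < x a b < 1.
Hypothesis x_spec : forall a b y, a <> b -> -1 <= y <= 1 ->
  G a y = G b y <-> y = x a b.
Hypothesis M_spec : forall a b, a <> b ->
  mark E (arc_point S e a (x a b)) (arc_point S e b (x a b)) = M a b.
Hypothesis slope_spec : forall a b, a <> b ->
  sgz (((G b)^`() (x a b))%classic - ((G a)^`() (x a b))%classic) = slope a b.
Hypothesis x_neq : forall a b c, distinct3 a b c -> x a b <> x a c.

Definition crossing_param a b : R := arc_param S e a (x a b).

Let x_le a b : a <> b -> -1 <= x a b <= 1.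
Proof. by move=> /x_in/andP[/ltW -> /ltW ->]. Qed.

Let G_meet a b : a <> b -> G a (x a b) = G b (x a b).
Proof. by move=> ab; apply/x_spec => //; exact: x_le. Qed.

Lemma crossing_on a b i : a <> b -> strand_comp (S a) = i ->
  on_strand (S a) (i, crossing_param a b).
Proof. by move=> ab <-; exact: (arc_point_on sys a (x_le ab)). Qed.

Lemma crossing_sgn a b i : a <> b -> strand_comp (S a) = i -> strand_comp (S b) = i ->
  sgn E (i, crossing_param a b) (i, crossing_param b a) =
  sgz (Defs.jacobian phi (0, 0)) * (direction e a * direction e b) * slope a b.
Proof.
move=> ab ca cb; have := sgn_arc sys ab (x_in ab) (G_meet ab).
by rewrite -(slope_spec ab) /crossing_param [x b a]x_sym /arc_point ca cb.
Qed.

Let M_flip a b : a <> b -> M b a = flip_mark (M a b).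
Proof.
move=> ab; rewrite -(M_spec ab) -(M_spec (nesym ab)) x_sym.
apply: (generic_mark (arc_generic sys)).
by apply: (double_arc sys) => //; [exact: x_le|exact: G_meet].
Qed.

Lemma triangle_sum a b c (V : nmodType) (q : crossing_mark -> bool) i
  (F : R * R -> V) :
  distinct3 a b c ->
  \sum_(y \in [set y | double_pairs E i y /\ q (mark E (i, y.1) (i, y.2))]
              `&` strand_pairs S i) F y =
  \sum_(p <- strand_pairs3 a b c | [&& strand_comp (S p.1) == i,
      strand_comp (S p.2) == i & q (M p.1 p.2)])
    F (crossing_param p.1 p.2, crossing_param p.2 p.1).
Proof.
move=> abc; pose lab (p : 'I_3 * 'I_3) := (p.1, p.2, x p.1 p.2).
have L_uniq : uniq (map lab (strand_pairs3 a b c)).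
  by rewrite map_inj_uniq ?strand_pairs3_uniq // => -[? ?] [? ?] [-> ->].
have L_spec d f y : (d, f, y) \in map lab (strand_pairs3 a b c) <->
    [/\ d <> f, -1 <= y <= 1 & G d y = G f y].
  split.
    move=> /mapP[[d' f']]; rewrite mem_strand_pairs3 // => /eqP df [-> -> ->] /=.
    by split=> //; [exact: x_le|exact: G_meet].
  move=> [df yi /x_spec -> //]; apply/mapP; exists (d, f) => //.
  by rewrite mem_strand_pairs3 //; apply/eqP.
have M_lab d f y : (d, f, y) \in map lab (strand_pairs3 a b c) ->
    mark E (arc_point S e d y) (arc_point S e f y) = M d f.
  by move=> /L_spec[df yi /x_spec -> //]; exact: M_spec.
apply: etrans (crossing_sum sys L_uniq L_spec M_lab q i F) _.
rewrite big_map; apply: eq_bigr => p _.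
by rewrite /crossing_pair /crossing_param /= [x p.2 p.1]x_sym.
Qed.

Definition precedes a b : bool := strand_lo (S a) < strand_lo (S b).

Definition meets_first a b c : bool :=
  if e a then x a b < x a c else ~~ (x a b < x a c).

Let param_lt a b d f i : a <> b -> a <> d -> b <> f ->
  strand_comp (S a) = i -> strand_comp (S b) = i ->
  (crossing_param a d < crossing_param b f) = precedes a b /\
  crossing_param a d != crossing_param b f.
Proof.
move=> ab ad bf ca cb; split.
  apply: (strand_lt sys ab); first by rewrite ca cb.
    exact: (arc_param_in sys a (x_le ad)).
  exact: (arc_param_in sys b (x_le bf)).
apply/eqP => E1; apply: ab; apply: (arc_disjoint sys (crossing_on ad ca)).
by rewrite E1; exact: crossing_on.
Qed.

Let param_same a b c : distinct3 a b c ->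
  (crossing_param a b < crossing_param a c) = meets_first a b c /\
  crossing_param a c != crossing_param a b.
Proof.
move=> abc; split.
  rewrite (arc_param_lt sys) /meets_first; case: (e a) => //.
  by rewrite -leNgt le_eqVlt eq_sym; have /eqP/negPf -> := x_neq abc.
rewrite (can_eq (arc_paramK sys a)) eq_sym; apply/eqP; exact: x_neq.
Qed.

(** Inside the disc, the index of the crossing of strands a and b sees only the
    crossings of the third strand c with a and with b. *)
Lemma triangle_index a b c i : distinct3 a b c ->
  strand_comp (S a) = i -> strand_comp (S b) = i -> nonvirtual (M a b) ->
  nonvirtual (M b c) = nonvirtual (M a c) ->
  \sum_(y \in flat_pairs E i `&` strand_pairs S i)
     weight E i (crossing_param a b) (crossing_param b a) y =
  if (strand_comp (S c) == i) && nonvirtual (M a c) then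
    sgz (Defs.jacobian phi (0, 0)) * (direction e a * direction e c) * slope a c
      * ((meets_first a b c (+) precedes b a)%:R - (precedes a c (+) precedes b
        c)%:R) +
    sgz (Defs.jacobian phi (0, 0)) * (direction e b * direction e c) * slope b c
      * ((precedes a b (+) meets_first b a c)%:R - (precedes a c (+) precedes b c)%:R)
  else 0.
Proof.
move=> abc ca cb nab nbc; have [ab ac bc] := abc.
have bac : distinct3 b a c by split=> //; exact: nesym.
rewrite flat_pairsE; apply: etrans (triangle_sum _ _ _ abc) _.
rewrite big_mkcond /strand_pairs3 !big_cons big_nil /=.
rewrite !ca !cb eqxx /= (M_flip ab) (M_flip ac) (M_flip bc) !nonvirtual_flip nab nbc.
set s := crossing_param a b; set t := crossing_param b a.
have w1 : weight E i s t (s, t) = 0 by apply: weight_endpoints; left.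
have w2 : weight E i s t (t, s) = 0 by apply: weight_endpoints; right.
have sum6 (s1 s2 s3 s4 s5 s6 p q : int) : s1 = 0 -> s2 = 0 -> s3 + s4 = p ->
    s5 + s6 = q -> s1 + (s2 + (s3 + (s4 + (s5 + (s6 + 0))))) = p + q.
  by move=> -> -> <- <-; rewrite !add0r addr0 !addrA.
case cc: (strand_comp (S c) == i) => /=; last first.
  by apply: etrans (sum6 _ _ _ _ _ _ 0 0 w1 w2 _ _) _; rewrite ?addr0.
case: (nonvirtual (M a c)) => /=; last first.
  by apply: etrans (sum6 _ _ _ _ _ _ 0 0 w1 w2 _ _) _; rewrite ?addr0.
move/eqP: cc => cc.
have [sac sacN] := param_same abc; have [tbc tbcN] := param_same bac.
have [t_ac t_acN] := param_lt (nesym ab) (nesym ab) ac cb ca.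
have [s_ca s_caN] := param_lt ac ab (nesym ac) ca cc.
have [t_ca t_caN] := param_lt bc (nesym ab) (nesym ac) cb cc.
have [s_cb s_cbN] := param_lt ac ab (nesym bc) ca cc.
have [t_cb t_cbN] := param_lt bc (nesym ab) (nesym bc) cb cc.
have [s_bc s_bcN] := param_lt ab ab bc ca cb.
rewrite -/s -/t in sac sacN tbc tbcN t_ac t_acN s_ca s_caN t_ca t_caN s_cb s_cbN
  t_cb t_cbN s_bc s_bcN.
rewrite eq_sym in t_acN; rewrite eq_sym in s_caN; rewrite eq_sym in t_caN.
rewrite eq_sym in s_cbN; rewrite eq_sym in t_cbN; rewrite eq_sym in s_bcN.
have I1 := insideE sacN t_acN; rewrite sac t_ac in I1.
have I2 := insideE s_caN t_caN; rewrite s_ca t_ca in I2.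
have I3 := insideE s_bcN tbcN; rewrite s_bc tbc in I3.
have I4 := insideE s_cbN t_cbN; rewrite s_cb t_cb in I4.
apply: sum6 => //.
  apply: etrans (weight_pair E i sacN t_acN s_caN t_caN) _.
  by rewrite I1 I2 (crossing_sgn ac ca cc).
apply: etrans (weight_pair E i s_bcN tbcN s_cbN t_cbN) _.
by rewrite I3 I4 (crossing_sgn bc cb cc).
Qed.

End Triangle.

Section Reidemeister3.
Variables (R : realType) (n : nat) (phi : R * R -> R * R).
Variables (S : 'I_3 -> strand R n) (e : 'I_3 -> bool) (G G' : 'I_3 -> R -> R).
Variables (D D' : diagram R n) (M : 'I_3 -> 'I_3 -> crossing_mark).
Variables (x x' : 'I_3 -> 'I_3 -> R) (slope : 'I_3 -> 'I_3 -> int).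
Hypothesis change : local_change phi S (fun a => graph_arc (S a) (e a) (G a))
  (fun a => graph_arc (S a) (e a) (G' a)) D D'.
Hypotheses (sys : arc_system phi S e G D) (sys' : arc_system phi S e G' D').
Hypotheses (x_sym : forall a b, x a b = x b a)
  (x_sym' : forall a b, x' a b = x' b a).
Hypotheses (x_in : forall a b, a <> b -> -1 < x a b < 1)
  (x_in' : forall a b, a <> b -> -1 < x' a b < 1).
Hypotheses
  (x_spec : forall a b y, a <> b -> -1 <= y <= 1 -> G a y = G b y <-> y = x a b)
  (x_spec' : forall a b y, a <> b -> -1 <= y <= 1 ->
     G' a y = G' b y <-> y = x' a b).
Hypotheses
  (M_spec : forall a b, a <> b ->
     mark D (arc_point S e a (x a b)) (arc_point S e b (x a b)) = M a b)
  (M_spec' : forall a b, a <> b ->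
     mark D' (arc_point S e a (x' a b)) (arc_point S e b (x' a b)) = M a b).
Hypotheses
  (slope_spec : forall a b, a <> b ->
     sgz (((G b)^`() (x a b))%classic - ((G a)^`() (x a b))%classic) = slope a b)
  (slope_spec' : forall a b, a <> b ->
     sgz (((G' b)^`() (x' a b))%classic - ((G' a)^`() (x' a b))%classic) = slope a b).
Hypotheses (x_neq : forall a b c, distinct3 a b c -> x a b <> x a c)
  (x_neq' : forall a b c, distinct3 a b c -> x' a b <> x' a c).
Hypothesis M_mixed : forall a b c, distinct3 a b c -> nonvirtual (M a b) ->
  nonvirtual (M b c) = nonvirtual (M a c).
Hypothesis x_reverse : forall a b c, distinct3 a b c ->
  (x' a b < x' a c) = ~~ (x a b < x a c).
(* Both sides are the sign of G c - G a, or G c - G b, at the meeting point of the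
   graphs of G a and G b. *)
Hypothesis slope_order : forall a b c, distinct3 a b c ->
  (if x a b < x a c then - slope a c else slope a c) =
  (if x b a < x b c then - slope b c else slope b c).

Let gD := arc_generic sys.
Let gD' := arc_generic sys'.

Lemma meets_first_reverse a b c : distinct3 a b c ->
  meets_first e x' a b c = ~~ meets_first e x a b c.
Proof. by move=> abc; rewrite /meets_first x_reverse //; case: (e a). Qed.

Lemma precedesC a b i : a <> b -> strand_comp (S a) = i -> strand_comp (S b) = i ->
  precedes S b a = ~~ precedes S a b.
Proof.
move=> ab ca cb; rewrite /precedes -leNgt le_eqVlt; case: eqP => // E1.
case: ab; apply: (arc_disjoint sys (p := (i, strand_lo (S b)))).
  have [_ l _] := arc_strand_ok sys a.
  by split; [exact/esym|rewrite /= E1 lexx ltW].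
have [_ l _] := arc_strand_ok sys b.
by split; [exact/esym|rewrite /= lexx ltW].
Qed.

(** The move reverses the order in which each strand meets the two others.  So the
    crossing of c with a changes sides, as does that of c with b, and by
    [slope_order] the two changes cancel. *)
Lemma crossing_index a b c i : distinct3 a b c ->
  strand_comp (S a) = i -> strand_comp (S b) = i -> nonvirtual (M a b) ->
  intersection_index D i (crossing_param S e x a b) (crossing_param S e x b a) =
  intersection_index D' i (crossing_param S e x' a b) (crossing_param S e x' b a).
Proof.
move=> abc ca cb nab; have [ab ac bc] := abc.
have bac : distinct3 b a c by split=> //; exact: nesym.
apply: etrans (index_split S _ _ _ gD) _.
apply/esym; apply: etrans (index_split S _ _ _ gD') _; apply/esym.
have ona := crossing_on sys x_in ab ca.
have onb := crossing_on sys x_in (nesym ab) cb.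
have ona' := crossing_on sys' x_in' ab ca.
have onb' := crossing_on sys' x_in' (nesym ab) cb.
apply: (congr2 (fun a b => a + b)); last first.
  apply: (outer_weights gD gD' change) => u off.
  exact: (same_strand_outer ona ona' onb onb' off).
have mix := M_mixed abc nab.
apply: etrans (triangle_index sys x_sym x_in x_spec M_spec slope_spec x_neq
  abc ca cb nab mix) _.
apply/esym; apply: etrans (triangle_index sys' x_sym' x_in' x_spec' M_spec'
  slope_spec' x_neq' abc ca cb nab mix) _; apply/esym.
case: ifP => // _.
rewrite !meets_first_reverse // (precedesC ab ca cb) /meets_first.
have := slope_order abc; move: (sgz _) (slope a c) (slope b c) => J sa sb.
move: (x a b < x a c) (x b a < x b c) (precedes S a b)
  (precedes S a c (+) precedes S b c) => oa ob l k.
rewrite /direction; move: (if e c then _ else _) => ec.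
case: oa; case: ob; case: (e a); case: (e b); case: l; case: k => /=;
  first [by move=> /oppr_inj ->; ring | by move=> <-; ring | by move=> ->; ring].
Qed.

Lemma reidemeister3_arcs_p_sc a b c : distinct3 a b c -> p_sc D = p_sc D'.
Proof.
move=> abc.
have sgnE d f i : d <> f -> strand_comp (S d) = i -> strand_comp (S f) = i ->
   sgn D (i, crossing_param S e x d f) (i, crossing_param S e x f d) =
   sgn D' (i, crossing_param S e x' d f) (i, crossing_param S e x' f d).
  move=> df cd cf.
  apply: etrans (crossing_sgn sys x_sym x_in x_spec slope_spec df cd cf) _.
  by apply/esym; exact: (crossing_sgn sys' x_sym' x_in' x_spec' slope_spec' df cd cf).
apply: (local_p_sc gD gD' change) => [i s t offs offt|i].
  rewrite !flat_pairsE.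
  apply: etrans (triangle_sum sys x_sym x_in x_spec M_spec _ _ _ abc) _.
  apply/esym; apply: etrans
    (triangle_sum sys' x_sym' x_in' x_spec' M_spec' _ _ _ abc) _.
  apply/esym; apply: (eq_strand_pairs3 abc) => d f df /and3P[/eqP cd /eqP cf _].
  have ond := crossing_on sys x_in df cd.
  have onf := crossing_on sys x_in (nesym df) cf.
  have ond' := crossing_on sys' x_in' df cd.
  have onf' := crossing_on sys' x_in' (nesym df) cf.
  have [i1 _] := same_strand_inside offs offt ond ond'.
  have [_ i2] := same_strand_inside offs offt onf onf'.
  have [_ i3] := same_strand_inside offs offt onf' onf'.
  apply: (congr2 (fun (b : bool) (v : int) => if b then v else 0)); last exact: sgnE.
  by rewrite /= i1 i2 i3.
rewrite !self_crossingsE.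
apply: etrans (triangle_sum sys x_sym x_in x_spec M_spec _ _ _ abc) _.
apply/esym; apply: etrans
  (triangle_sum sys' x_sym' x_in' x_spec' M_spec' _ _ _ abc) _.
apply/esym; apply: (eq_strand_pairs3 abc) => d f df /and3P[/eqP cd /eqP cf over].
have nv : nonvirtual (M d f) by case: (M d f) over.
have [k dfk] : exists k, distinct3 d f k.
  have [ab ac bc] := abc; have ba := nesym ab; have ca := nesym ac;
    have cb := nesym bc.
  by case: (ord3_cover d abc) df => ->; case: (ord3_cover f abc) => -> // _;
    [exists c|exists b|exists c|exists a|exists b|exists a]; split.
apply: eq_crossing_term; last exact: sgnE.
by apply: (congr1 absz); exact: crossing_index dfk cd cf nv.
Qed.

End Reidemeister3.

Lemma ord3P (a : 'I_3) :
  [\/ a = @Ordinal 3 0 isT, a = @Ordinal 3 1 isT | a = @Ordinal 3 2 isT].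
Proof.
by case: a => -[|[|[|//]]] p; [constructor 1|constructor 2|constructor 3];
  apply/val_inj.
Qed.

Lemma distinct3E a b c : distinct3 a b c -> [&& a != b, a != c & b != c].
Proof. by move=> [/eqP -> /eqP -> /eqP ->]. Qed.

(** The sum of the indices identifies the pair of strands: 1 for the two lines,
    which meet at 0, then 2 and 3 for the graph with each of the lines. *)
Definition meeting_point (R : realType) (p q : R) (a b : 'I_3) : R :=
  match (val a + val b)%N with 1%N => 0 | 2%N => p | _ => q end.

(** The order of the three graphs, from bottom to top, at the left edge of the box.
    It is reversed at the right edge, since any two of them meet once. *)
Definition left_rank (a : 'I_3) : nat :=
  match val a with 0%N => 0%N | 1%N => 2%N | _ => 1%N end.

Definition triangle_slope (a b : 'I_3) : int :=
  if (left_rank a < left_rank b)%N then -1 else 1.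

Lemma meeting_pointC (R : realType) (p q : R) a b :
  meeting_point p q a b = meeting_point p q b a.
Proof. by rewrite /meeting_point addnC. Qed.

Section TriangleGraphs.
Variables (R : realType) (g : R -> R).
Hypothesis meets : meets_lines_once g.

Lemma derivable_triangle_graphs a x : derivable (triangle_graphs g a) x 1.
Proof.
have did : derivable (@id R) x 1 by exact: derivable_id.
have [[[dg _] _] _ _ _] := meets.
have lineE (c : R) : derivable (fun y : R => c *: y) x 1 by exact: derivableZ.
case: (ord3P a) => ->; rewrite /triangle_graphs /=; last exact: dg.
  have -> : (fun y : R => y / 2%:R) = (fun y => 2%:R^-1 *: y); last exact: lineE.
  by apply/funext => y; rewrite /GRing.scale /= mulrC.
have -> : (fun y : R => - y / 2%:R) = (fun y => (- 2%:R^-1) *: y); last exact: lineE.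
by apply/funext => y; rewrite /GRing.scale /= mulNr mulrC mulNr.
Qed.

Lemma triangle_meeting_points : exists p q : R,
  [/\ (forall a b, a <> b -> -1 < meeting_point p q a b < 1),
      (forall a b y, a <> b -> -1 <= y <= 1 ->
         triangle_graphs g a y = triangle_graphs g b y <->
         y = meeting_point p q a b),
      (forall a b, (left_rank a < left_rank b)%N ->
         ((triangle_graphs g b)^`() (meeting_point p q a b))%classic -
         ((triangle_graphs g a)^`() (meeting_point p q a b))%classic <= 0),
      0 < g 0 -> q < 0 < p & g 0 < 0 -> p < 0 < q].
Proof.
have [[_ _] bound [p [[p_in gp] p_uniq]] [q [[q_in gq] q_uniq]]] := meets.
exists p, q; pose f a b y := triangle_graphs g b y - triangle_graphs g a y.
have spec a b y : a <> b -> -1 <= y <= 1 ->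
    triangle_graphs g a y = triangle_graphs g b y <-> y = meeting_point p q a b.
  move=> /eqP + yi; case: (ord3P a) => ->; case: (ord3P b) => -> //= _;
    rewrite /triangle_graphs /meeting_point /=.
  - by split=> [h|->]; lra.
  - by split=> [h|->]; [apply/esym/p_uniq; split|].
  - by split=> [h|->]; lra.
  - by split=> [h|->]; [apply/esym/q_uniq; split|].
  - by split=> [h|->]; [apply/esym/p_uniq; split|].
  - by split=> [h|->]; [apply/esym/q_uniq; split|].
have mp_in a b : -1 <= meeting_point p q a b <= 1.
  by rewrite /meeting_point; case: (_ + _)%N => [|[|[|k]]] //; lra.
have bl : - 2%:R^-1 < g (-1) < 2%:R^-1 by apply: bound; lra.
have br : - 2%:R^-1 < g 1 < 2%:R^-1 by apply: bound; lra.
have main a b : (left_rank a < left_rank b)%N ->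
    [/\ -1 < meeting_point p q a b < 1, ((f a b)^`() (meeting_point p q a
      b))%classic <= 0,
     0 < f a b 0 -> 0 < meeting_point p q a b & f a b 0 < 0 ->
       meeting_point p q a b < 0].
  move=> rk; apply: single_zero => //.
  - by move=> x; apply: derivableB; exact: derivable_triangle_graphs.
  - move: rk; rewrite /f; case: (ord3P a) => ->; case: (ord3P b) => -> //= _;
      rewrite /triangle_graphs /=; lra.
  - move: rk; rewrite /f; case: (ord3P a) => ->; case: (ord3P b) => -> //= _;
      rewrite /triangle_graphs /=; lra.
  - move=> x xi; rewrite -spec //; last by move=> ab; rewrite ab ltnn in rk.
    by rewrite /f; split=> [/subr0_eq|->]; rewrite ?subrr.
have [_ _ p1 p2] := main (@Ordinal 3 0 isT) (@Ordinal 3 2 isT) isT.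
have [_ _ q1 q2] := main (@Ordinal 3 2 isT) (@Ordinal 3 1 isT) isT.
rewrite /f /triangle_graphs /meeting_point /= in p1 p2 q1 q2.
split=> //.
- move=> a b /eqP ab; case: (ltnP (left_rank a) (left_rank b)) => [/main[]//|ba].
  rewrite meeting_pointC; have [] // := main b a.
  by move: ab ba; case: (ord3P a) => ->; case: (ord3P b) => ->.
- move=> a b rk; have [_ + _ _] := main _ _ rk; rewrite !derive1E.
  have da : derivable (triangle_graphs g a) (meeting_point p q a b) 1.
    exact: derivable_triangle_graphs.
  have db : derivable (triangle_graphs g b) (meeting_point p q a b) 1.
    exact: derivable_triangle_graphs.
  by apply: le_trans; rewrite le_eqVlt (deriveB db da) eqxx.
- by move=> g0; apply/andP; split; [apply: q2|apply: p1]; lra.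
- by move=> g0; apply/andP; split; [apply: p2|apply: q1]; lra.
Qed.

End TriangleGraphs.

Section TriangleMove.
Variables (R : realType) (n : nat) (phi : R * R -> R * R).
Variables (S : 'I_3 -> strand R n) (e : 'I_3 -> bool).
Variable m : 'I_3 -> 'I_3 -> crossing_mark.

Definition triangle_mark (a b : 'I_3) : crossing_mark :=
  if (a < b)%N then m a b else flip_mark (m b a).

(** In a mixed triangle, a classical crossing is the one that avoids the strand
    with virtual crossings. *)
Lemma triangle_mark_mixed a b c : triangle_marks m -> distinct3 a b c ->
  nonvirtual (triangle_mark a b) ->
  nonvirtual (triangle_mark b c) = nonvirtual (triangle_mark a c).
Proof.
move=> tm abc; have [/eqP ab /eqP ac /eqP bc] := abc.
have nvE d f : d != f -> nonvirtual (triangle_mark d f) =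
    if (d < f)%N then nonvirtual (m d f) else nonvirtual (m f d).
  by move=> df; rewrite /triangle_mark; case: ifP; rewrite ?nonvirtual_flip.
have gtE (d f : 'I_3) : d != f -> (d < f)%N = false -> (f < d)%N.
  move=> df; move/negbT; rewrite -leqNgt leq_eqVlt => /orP[/eqP E|//].
  by case/eqP: df; apply/val_inj.
rewrite !nvE //; case: tm => [[level [_ lev]]|vir|[k mix]].
- have nv (d f : 'I_3) : d != f ->
  (if (d < f)%N then nonvirtual (m d f) else nonvirtual (m f d)).
    move=> df; case: ifP => [|/(gtE _ _ df)] lt.
      by rewrite lev //; case: ifP.
    by rewrite lev //; case: ifP.
  by rewrite !nv.
- by case: ifP => [|/(gtE _ _ ab)] lt; rewrite vir.
- have vk (d f : 'I_3) : d != f -> (d == k) || (f == k) ->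
      (if (d < f)%N then nonvirtual (m d f) else nonvirtual (m f d)) = false.
    move=> df dfk; case: ifP => [|/(gtE _ _ df)] lt.
      by have := mix _ _ lt; rewrite dfk => ->.
    by have := mix _ _ lt; rewrite orbC dfk => ->.
  have [dk|kab] := boolP ((a == k) || (b == k)); first by rewrite vk.
  move: kab; rewrite negb_or => /andP[/eqP ak /eqP bk] _.
  have ck : c == k.
    by case: (ord3_cover k abc) => kE; rewrite kE // in ak bk *.
  by rewrite !vk // ck orbT.
Qed.

Lemma triangle_mark_spec (G : 'I_3 -> R -> R) (E : diagram R n) x a b :
  arc_system phi S e G E ->
  (forall a b : 'I_3, (a < b)%N -> marked E (S a) (S b) (m a b)) ->
  a <> b -> -1 <= x <= 1 -> G a x = G b x ->
  mark E (arc_point S e a x) (arc_point S e b x) = triangle_mark a b.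
Proof.
move=> sys mk ab xi Gx; rewrite /triangle_mark; case: ltngtP => lt.
- apply: mk => //; [exact: (arc_point_on sys)|exact: (arc_point_on sys)|].
  exact: (double_arc sys).
- have dba := double_arc sys (nesym ab) xi (esym Gx).
  rewrite (generic_mark (arc_generic sys) dba); congr flip_mark.
  by apply: mk; [|exact: (arc_point_on sys)|exact: (arc_point_on sys)|].
- by case: ab; apply/val_inj.
Qed.

Lemma triangle_slope_spec (g : R -> R) (E : diagram R n) x a b :
  arc_system phi S e (triangle_graphs g) E ->
  -1 < x < 1 -> a <> b -> triangle_graphs g a x = triangle_graphs g b x ->
  ((left_rank a < left_rank b)%N ->
    ((triangle_graphs g b)^`() x)%classic - ((triangle_graphs g a)^`() x)%classic
      <= 0) ->
  ((left_rank b < left_rank a)%N ->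
    ((triangle_graphs g a)^`() x)%classic - ((triangle_graphs g b)^`() x)%classic
      <= 0) ->
  sgz (((triangle_graphs g b)^`() x)%classic - ((triangle_graphs g a)^`() x)%classic)
  = triangle_slope a b.
Proof.
move=> sys xi ab gx; have := transverse_arc sys ab xi gx.
move: ((triangle_graphs g a)^`() x)%classic ((triangle_graphs g b)^`() x)%classic.
move=> da db /eqP nz; rewrite /triangle_slope; case: ltngtP => rk.
- by move=> /(_ isT) le0 _; rewrite ltr0_sgz // lt_neqAle nz.
- by move=> _ /(_ isT) le0; rewrite gtr0_sgz // lt_neqAle eq_sym nz -oppr_le0 opprB.
- by case: ab; move: rk; case: (ord3P a) => ->; case: (ord3P b) => ->.
Qed.

End TriangleMove.

Lemma reidemeister3_p_sc (R : realType) (n : nat) (D D' : diagram R n) :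
  generic_diagram D -> generic_diagram D' -> reidemeister3 D D' -> p_sc D = p_sc D'.
Proof.
move=> gD gD' [phi [S [e [g [h [m [change [mg g0] [mh h0] tm mk]]]]]]].
have dg := derivable_triangle_graphs mg; have dh := derivable_triangle_graphs mh.
have [sys sys'] := local_change_arc_system gD gD' dg dh change.
have [p [q [x_in x_spec slope posg _]]] := triangle_meeting_points mg.
have [p' [q' [x_in' x_spec' slope' _ negh]]] := triangle_meeting_points mh.
have /andP[q0 p0] := posg g0; have qp := lt_trans q0 p0.
have /andP[p0' q0'] := negh h0.
have x_le a b (ab : a <> b) : -1 <= meeting_point p q a b <= 1.
  by case/andP: (x_in a b ab) => /ltW -> /ltW ->.
have x_le' a b (ab : a <> b) : -1 <= meeting_point p' q' a b <= 1.
  by case/andP: (x_in' a b ab) => /ltW -> /ltW ->.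
have meet a b (ab : a <> b) := (x_spec a b _ ab (x_le a b ab)).2 erefl.
have meet' a b (ab : a <> b) := (x_spec' a b _ ab (x_le' a b ab)).2 erefl.
apply: (@reidemeister3_arcs_p_sc _ _ _ _ _ _ _ _ _ (triangle_mark m)
  (meeting_point p q) (meeting_point p' q') triangle_slope change sys sys') => //.
- exact: meeting_pointC.
- exact: meeting_pointC.
- move=> a b ab; apply: (triangle_mark_spec sys) => //; [|exact: x_le|exact: meet].
  by move=> c d cd; have [] := mk c d cd.
- move=> a b ab; apply: (triangle_mark_spec sys') => //; [|exact: x_le'|exact: meet'].
  by move=> c d cd; have [] := mk c d cd.
- move=> a b ab; apply: (triangle_slope_spec sys) => //; [exact: x_in|exact: meet| |].
    exact: slope.
  by rewrite meeting_pointC; exact: slope.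
- move=> a b ab; apply: (triangle_slope_spec sys') => //;
  [exact: x_in'|exact: meet'| |].
    exact: slope'.
  by rewrite meeting_pointC; exact: slope'.
- move=> a b c /distinct3E; case: (ord3P a) => ->; case: (ord3P b) => ->;
    case: (ord3P c) => -> //= _; rewrite /meeting_point /=; lra.
- move=> a b c /distinct3E; case: (ord3P a) => ->; case: (ord3P b) => ->;
    case: (ord3P c) => -> //= _; rewrite /meeting_point /=; lra.
- by move=> a b c; exact: triangle_mark_mixed.
- move=> a b c /distinct3E; case: (ord3P a) => ->; case: (ord3P b) => ->;
    case: (ord3P c) => -> //= _; rewrite /meeting_point /=; lra.
- move=> a b c /distinct3E; case: (ord3P a) => ->; case: (ord3P b) => ->;
    case: (ord3P c) => -> //= _; rewrite /meeting_point /triangle_slope /=;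
    by rewrite ?p0 ?(lt_gtF p0) ?q0 ?(lt_gtF q0) ?qp ?(lt_gtF qp).
- have abc : distinct3 (@Ordinal 3 0 isT) (@Ordinal 3 1 isT) (@Ordinal 3 2 isT).
    by split.
  exact: abc.
Qed.

(** * The theorem *)

Lemma p_sc_invariant (R : realType) (n : nat) : tangle_invariant (@p_sc R n).
Proof.
move=> D D'; elim=> {D D'}
  [D D' [gD _] [gD' _] mv|//|D D' _ ->//|D D' D'' _ -> _ ->//].
case: mv => [[|]|||].
- exact: reparametrized_p_sc.
- exact: planar_isotopic_p_sc.
- exact: reidemeister1_p_sc.
- exact: reidemeister2_p_sc.
- exact: reidemeister3_p_sc.
Qed.

Theorem proposition3p1p1 (R : realType) (n : nat) :
  finite_type_order_le (@p_sc R n) 1.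
Proof.
split; first exact: p_sc_invariant.
move=> D ds gD [uds sing asym]; apply: extend_p_sc_eq0 => // d dds.
have := asym d.1 d.2 (sing d dds); rewrite -surjective_pairing dds /=.
by case: (_ \in ds).
Qed.
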